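(* Let $n,m\ge 2$ be integers such that $(n-1)\nmid(m-1)$. Then for every group homomorphism $\rho\colon V_{m,1}\to V_{n,1}$, the action of $\rho(V_{m,1}')$ on $X_n$ has a non-empty clopen set of global fixed points.
   Context: For $n\ge 2$ let $X_n=\{1,\dots,n\}^{\mathbb{N}}$, the Cantor set of one-sided infinite sequences. The Higman–Thompson group $V_{n,1}$ is the group of all homeomorphisms $g$ of $X_n$ for which there exist finite collections of finite words $\{v_i\}_{i=1}^{\ell}$ and $\{w_i\}_{i=1}^{\ell}$ over $\{1,\dots,n\}$ such that every sequence in $X_n$ begins with one of the words $v_i$ as a prefix, and $g(v_ix)=w_ix$ for every $i$ and every $x\in X_n$. $V_{m,1}'$ denotes the derived (commutator) subgroup of $V_{m,1}$. A global fixed point of a group action is a point fixed by every element of the group. *)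

(* Defs.v *)
From HB Require Import structures.
From mathcomp Require Import all_boot.
From mathcomp Require Import boolp classical_sets topology.

Set Implicit Arguments.
Unset Strict Implicit.
Unset Printing Implicit Defensive.

Local Open Scope group_scope.
Local Open Scope classical_set_scope.

(* Homeomorphisms of T, with composition (f * g) x = f (g x). *)
Record homeo (T : topologicalType) := Homeo {
  homeo_fun :> T -> T;
  homeo_inv : T -> T;
  homeo_fun_continuous : continuous homeo_fun;
  homeo_inv_continuous : continuous homeo_inv;
  homeo_funK : cancel homeo_fun homeo_inv;
  homeo_invK : cancel homeo_inv homeo_fun
}.

Section HomeoGroup.
Variable T : topologicalType.
Implicit Types f g h : homeo T.

Lemma homeoP f g : (forall x, f x = g x) -> f = g.
Proof.
case: f g => [f f' cf cf' fK f'K] [g g' cg cg' gK g'K] /= /funext fg.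
subst g; have f'g' : f' = g'.
  by apply/funext => x; rewrite -[in LHS](g'K x) fK.
subst g'; congr Homeo; exact: Prop_irrelevance.
Qed.

HB.instance Definition _ := gen_eqMixin (homeo T).
HB.instance Definition _ := gen_choiceMixin (homeo T).

Definition homeo_one : homeo T :=
  @Homeo T id id (fun _ => cvg_id) (fun _ => cvg_id) (fun=> erefl) (fun=> erefl).

Definition homeo_invg f : homeo T :=
  Homeo (@homeo_inv_continuous _ f) (@homeo_fun_continuous _ f)
        (@homeo_invK _ f) (@homeo_funK _ f).

Lemma comp_continuous (f g : T -> T) :
  continuous f -> continuous g -> continuous (f \o g).
Proof. by move=> cf cg x; apply: continuous_comp; [exact: cg|exact: cf]. Qed.

Definition homeo_mul f g : homeo T :=
  Homeo (comp_continuous (@homeo_fun_continuous _ f) (@homeo_fun_continuous _ g))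
        (comp_continuous (@homeo_inv_continuous _ g) (@homeo_inv_continuous _ f))
        (can_comp (@homeo_funK _ f) (@homeo_funK _ g))
        (can_comp (@homeo_invK _ g) (@homeo_invK _ f)).

Fact homeo_mulA : associative homeo_mul.
Proof. by move=> f g h; apply: homeoP. Qed.
Fact homeo_mul1 : left_id homeo_one homeo_mul.
Proof. by move=> f; apply: homeoP. Qed.
Fact homeo_mulr1 : right_id homeo_one homeo_mul.
Proof. by move=> f; apply: homeoP. Qed.
Fact homeo_mulV : left_inverse homeo_one homeo_invg homeo_mul.
Proof. by move=> f; apply: homeoP => x; exact: homeo_funK. Qed.
Fact homeo_mulrV : right_inverse homeo_one homeo_invg homeo_mul.
Proof. by move=> f; apply: homeoP => x; exact: homeo_invK. Qed.

HB.instance Definition _ := isGroup.Build (homeo T)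
  homeo_mulA homeo_mul1 homeo_mulr1 homeo_mulV homeo_mulrV.

End HomeoGroup.

(* The alphabet {1, ..., n} is rendered as 'I_n = {0, ..., n - 1}. *)
Definition cantor (n : nat) : Type :=
  prod_topology (fun _ : nat => discrete_topology 'I_n).
HB.instance Definition _ n := Topological.on (cantor n).

(* The concatenation v x: past the end of v, nth returns its default value,
   which is the entry of x of index i - size v. *)
Definition prepend n (v : seq 'I_n) (x : cantor n) : cantor n :=
  fun i => nth (x (i - size v)%N) v i.

(* s is the list of the pairs (v_i, w_i); the v_i need not be incomparable. *)
Definition prefix_replacement n (g : homeo (cantor n)) : Prop :=
  exists s : seq (seq 'I_n * seq 'I_n),
    (forall x : cantor n, exists2 p, p \in s & exists y, x = prepend p.1 y) /\
    (forall p, p \in s ->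
       forall x : cantor n, g (prepend p.1 x) = prepend p.2 x).

Definition prefix_replacement_pred n : {pred homeo (cantor n)} :=
  fun g => `[< prefix_replacement g >].

Section ThompsonGroup.
Variable n : nat.
Implicit Types (u v w : seq 'I_n) (x y : cantor n).

Lemma prepend_nil x : prepend [::] x = x.
Proof. by apply/funext => i; rewrite /prepend nth_nil subn0. Qed.

Lemma prepend_cat u v x : prepend (u ++ v) x = prepend u (prepend v x).
Proof.
apply/funext => i; rewrite /prepend nth_cat size_cat subnDA.
by case: ltnP => // iu; [apply: set_nth_default | rewrite [RHS]nth_default].
Qed.

Lemma prepend_lt v x i : (i < size v)%N -> prepend v x i = nth (x 0%N) v i.
Proof. exact: set_nth_default. Qed.

Lemma prepend_inj v : injective (prepend v).
Proof.
move=> x y /(congr1 (fun z : cantor n => z \o addn (size v))) xy.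
apply/funext => i; move: (congr1 (@^~ i) xy) => /=.
by rewrite /prepend addKn !nth_default ?leq_addr.
Qed.

Lemma prepend_prefix v w x y : (size v <= size w)%N ->
  prepend v x = prepend w y -> w = v ++ drop (size v) w.
Proof.
move=> vw xy; rewrite -{1}(cat_take_drop (size v) w); congr (_ ++ _).
apply: (@eq_from_nth _ (x 0%N)); first by rewrite size_takel.
move=> i; rewrite size_takel // => iv; rewrite nth_take //.
have := congr1 (@^~ i) xy; rewrite (prepend_lt _ iv) => ->.
by apply: set_nth_default; exact: leq_trans vw.
Qed.

Fact prefix_replacement_one : prefix_replacement (1 : homeo (cantor n)).
Proof.
exists [:: ([::], [::])]; split=> [x|p].
  exists ([::], [::]); first exact: mem_head.
  by exists x; rewrite prepend_nil.
by rewrite inE => /eqP -> x; rewrite prepend_nil.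
Qed.

Fact prefix_replacement_inv (g : homeo (cantor n)) :
  prefix_replacement g -> prefix_replacement g^-1.
Proof.
move=> [s [cover_s gs]]; exists [seq (p.2, p.1) | p <- s]; split=> [x|p].
  have [p ps [y xy]] := cover_s (homeo_inv g x).
  exists (p.2, p.1); first by apply/mapP; exists p.
  by exists y; rewrite -[x](@homeo_invK _ g) xy gs.
by case/mapP => q qs -> x /=; rewrite -(gs q qs) [LHS](@homeo_funK _ g).
Qed.

Fact prefix_replacement_mul (h g : homeo (cantor n)) :
  prefix_replacement h -> prefix_replacement g -> prefix_replacement (h * g).
Proof.
move=> [t [cover_t ht]] [s [cover_s gs]].
pose glue (p q : seq 'I_n * seq 'I_n) : seq 'I_n * seq 'I_n :=
  if (size q.1 <= size p.2)%N then (p.1, q.2 ++ drop (size q.1) p.2)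
  else (p.1 ++ drop (size p.2) q.1, q.2).
pose compat (p q : seq 'I_n * seq 'I_n) :=
  if (size q.1 <= size p.2)%N then p.2 == q.1 ++ drop (size q.1) p.2
  else q.1 == p.2 ++ drop (size p.2) q.1.
exists [seq glue pq.1 pq.2 |
  pq <- [seq pq <- [seq (p, q) | p <- s, q <- t] | compat pq.1 pq.2]].
split=> [x|r].
  have [p ps [y xy]] := cover_s x.
  have [q qt [z yz]] := cover_t (g x).
  have pq : prepend p.2 y = prepend q.1 z by rewrite -gs // -xy.
  exists (glue p q).
    apply/mapP; exists (p, q) => //; rewrite mem_filter; apply/andP; split.
      rewrite /compat /=; case: leqP => qp; apply/eqP.
        exact: prepend_prefix qp (esym pq).
      exact: prepend_prefix (ltnW qp) pq.
    by apply/allpairsP; exists (p, q).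
  rewrite /glue; case: leqP => qp; first by exists y.
  exists z; rewrite prepend_cat xy; congr prepend.
  apply: (@prepend_inj p.2); rewrite pq -prepend_cat.
  by rewrite -(prepend_prefix (ltnW qp) pq).
case/mapP => -[p q]; rewrite mem_filter => /andP[/= cpq].
case/allpairsP => -[p' q'] /= [ps qt [ep eq]] -> x; subst p' q'.
change (h (g (prepend (glue p q).1 x)) = prepend (glue p q).2 x).
move: cpq; rewrite /compat /glue; case: leqP => _ /= /eqP e.
  by rewrite gs // {1}e prepend_cat ht // -prepend_cat.
by rewrite prepend_cat gs // -prepend_cat -e ht.
Qed.

Fact prefix_replacement_group_closed :
  group_closed (@prefix_replacement_pred n).
Proof.
split; first by apply/asboolP; exact: prefix_replacement_one.
move=> h g /asboolP hP /asboolP gP; apply/asboolP.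
by apply: prefix_replacement_mul => //; exact: prefix_replacement_inv.
Qed.

End ThompsonGroup.

(* The Higman-Thompson group V_{n,1}. *)
Record higman_thompson (n : nat) := HigmanThompson {
  ht_homeo :> homeo (cantor n);
  ht_homeoP : ht_homeo \in @prefix_replacement_pred n
}.

HB.instance Definition _ n := [isSub for @ht_homeo n].
HB.instance Definition _ n := [Choice of higman_thompson n by <:].
HB.instance Definition _ n :=
  SubChoice_isSubGroup.Build _ _ (higman_thompson n)
    (@prefix_replacement_group_closed n).

Definition is_subgroup (G : groupType) (H : set G) : Prop :=
  H 1 /\ forall x y, H x -> H y -> H (x * y^-1).

Definition derived_subgroup (G : groupType) : set G :=
  smallest (@is_subgroup G) [set z | exists x y : G, z = [~ x, y]].
Arguments derived_subgroup : clear implicits.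

Definition global_fixed_points n (H : set (higman_thompson n)) :
    set (cantor n) :=
  [set x | forall h, H h -> h x = x].

(* Main.v *)
Require Import Defs.
From HB Require Import structures.
From mathcomp Require Import all_boot zify.
From mathcomp Require Import mathcomp_extra boolp classical_sets topology.

(** Let V_m act on the Cantor set X_n through rho. A word stands for the cone of
    the points that begin with it.

    In V_m, the three-cycles of disjoint cones contained in an open set E generate
    a group [alternating E]. These groups are perfect ([alternating_perfect]) and
    almost simple in the sense of [normal_closure]; the groups of two overlapping
    open sets generate that of the union ([alternating_overlap]); and the group of
    the whole Cantor set contains the derived subgroup ([derived_sub_alternating]).

    In V_n, the germs at a common fixed point commute ([locally_fixed_commutator]),
    and the dynamics is hyperbolic: some power delta of a given element is such that
    the points moved by delta are attracted, in the past or in the future, by the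
    boundary of the set of fixed points of delta, which is finite
    ([commuting_fixes_moved], [frontier_fixed_power]).

    These facts together imply that disjoint open sets E and F of X_m move disjoint
    sets of points of X_n ([moved_disjoint]). A perfect group without finite
    quotients that commutes with delta has to act trivially on that boundary, then
    near it, and then on all that delta moves. So a power of some element of
    [alternating E] acts trivially on what F moves, and [normal_closure] concludes.
    A combinatorial argument on overlapping open sets then shows that a point moved
    by E and F together is moved by one of them ([moved_union]). In other words, the
    points moved by the whole group map equivariantly to X_m.

    Two cases remain. If the whole group [alternating setT] has a fixed point x, then
    finitely many elements without common fixed point in X_m fix a neighbourhood of
    x, which thus contains no point that maps to X_m: a whole cone is fixed
    ([unmoved_near]). Otherwise X_n is the disjoint union of the sets moved by the m
    cones of depth 1, and each of these splits into m sets in the same way. The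
    number of cones in a partition of a clopen subset of X_n is an invariant modulo
    n - 1 under the action of V_n ([tiles_size], [tiling_size_invariant]); computing
    it shows that m = 1 modulo n - 1 ([dvdn_of_all_moved]), which is excluded. *)

Set Implicit Arguments.
Unset Strict Implicit.
Unset Printing Implicit Defensive.

Local Open Scope classical_set_scope.

(** * Words, points and cones *)

Section Words.
Local Open Scope nat_scope.
Variable n : nat.
Implicit Types (u v w z : seq 'I_n) (x y : cantor n).

Definition pfx (k : nat) x : seq 'I_n := mkseq x k.
Definition shift (k : nat) x : cantor n := fun i => x (k + i).
Definition begins u x : bool := pfx (size u) x == u.
Definition incomparable u v : bool := ~~ prefix u v && ~~ prefix v u.

Lemma size_pfx k x : size (pfx k x) = k.
Proof. exact: size_mkseq. Qed.

Lemma nth_pfx a k x i : i < k -> nth a (pfx k x) i = x i.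
Proof. exact: nth_mkseq. Qed.

Lemma pfxK k x : prepend (pfx k x) (shift k x) = x.
Proof.
apply/funext => i; rewrite /prepend /shift size_pfx.
case: (ltnP i k) => ik; first by rewrite nth_pfx.
by rewrite nth_default ?size_pfx // subnKC.
Qed.

Lemma prepend_ge v x i : size v <= i -> prepend v x i = x (i - size v).
Proof. by move=> vi; rewrite /prepend nth_default. Qed.

Lemma pfx_prepend v x : pfx (size v) (prepend v x) = v.
Proof.
apply: (@eq_from_nth _ (x 0)); rewrite size_pfx // => i iv.
by rewrite nth_pfx // prepend_lt.
Qed.

Lemma begins_prepend v x : begins v (prepend v x).
Proof. by rewrite /begins pfx_prepend. Qed.

Lemma beginsP u x : reflect (exists y, x = prepend u y) (begins u x).
Proof.
apply: (iffP eqP) => [<-|[y ->]]; last exact: pfx_prepend.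
by exists (shift (size u) x); rewrite pfxK.
Qed.

Lemma begins_pfx k x : begins (pfx k x) x.
Proof. by rewrite /begins size_pfx. Qed.

Lemma pfx_eqP k x y : pfx k x = pfx k y <-> forall i, i < k -> x i = y i.
Proof.
split=> [e i ik|e]; first by rewrite -(nth_pfx (x 0) x ik) e nth_pfx.
apply: (@eq_from_nth _ (x 0)); rewrite !size_pfx // => i ik.
by rewrite !nth_pfx // e.
Qed.

Lemma pfx_le k l x y : k <= l -> pfx l x = pfx l y -> pfx k x = pfx k y.
Proof. by move=> kl /pfx_eqP e; apply/pfx_eqP => i ik; apply/e/(leq_trans ik). Qed.

Lemma pfxD k l x : pfx (k + l) x = pfx k x ++ pfx l (shift k x).
Proof. by rewrite /pfx /mkseq iotaD map_cat add0n -[X in iota X l]addn0 iotaDl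
  -map_comp. Qed.

Lemma pfxS k x : pfx k.+1 x = rcons (pfx k x) (x k).
Proof. exact: mkseqS. Qed.

Lemma begins_catl u v x : begins (u ++ v) x -> begins u x.
Proof. by case/beginsP => y ->; rewrite prepend_cat begins_prepend. Qed.

Lemma begins_prefix u v x : prefix u v -> begins v x -> begins u x.
Proof. by case/prefixP => w ->; exact: begins_catl. Qed.

Lemma begins_comparable u v x :
  begins u x -> begins v x -> size u <= size v -> prefix u v.
Proof.
move=> /eqP xu /eqP xv uv; rewrite -xu -xv -(subnKC uv) pfxD.
exact: prefix_prefix.
Qed.

Lemma incomparableC u v : incomparable u v = incomparable v u.
Proof. by rewrite /incomparable andbC. Qed.

Lemma incomparable_begins u v x : incomparable u v -> begins u x -> ~~ begins v x.
Proof.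
case/andP => uv vu xu; apply/negP => xv.
case: (leqP (size u) (size v)) => [l|/ltnW l].
  by rewrite (begins_comparable xu xv l) in uv.
by rewrite (begins_comparable xv xu l) in vu.
Qed.

Lemma incomparable_disjoint u v :
  0 < n -> (forall x, begins u x -> ~~ begins v x) -> incomparable u v.
Proof.
move=> n0 uv; pose x0 : cantor n := fun _ => Ordinal n0.
apply/andP; split; apply/negP.
  move=> p; have := uv _ (begins_prefix p (begins_prepend v x0)).
  by rewrite begins_prepend.
move=> p; have := uv _ (begins_prepend u x0).
by rewrite (begins_prefix p (begins_prepend u x0)).
Qed.

Lemma prefix_total u v w : prefix u w -> prefix v w -> prefix u v || prefix v u.
Proof.
move=> /prefixP[a ->]; rewrite prefixE => /eqP e.
case: (leqP (size v) (size u)) => l.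
  by rewrite -e takel_cat // prefix_take orbT.
by rewrite -e take_cat ltnNge (ltnW l) /= prefix_prefix.
Qed.

Lemma incomparable_cat u v a b : incomparable u v -> incomparable (u ++ a) (v ++ b).
Proof.
rewrite /incomparable -!negb_or; apply: contra => /orP[] /catl_prefix p.
  exact: prefix_total p (prefix_prefix _ _).
exact: prefix_total (prefix_prefix _ _) p.
Qed.

Lemma incomparable_catl u v a : incomparable u v -> incomparable (u ++ a) v.
Proof. by rewrite -{2}[v]cats0; exact: incomparable_cat. Qed.

Lemma incomparable_catr u v a : incomparable u v -> incomparable u (v ++ a).
Proof. by rewrite -{2}[u]cats0; exact: incomparable_cat. Qed.

Lemma incomparable_cat2l u a b : incomparable (u ++ a) (u ++ b) = incomparable a b.
Proof. by rewrite /incomparable !prefix_catr // eqxx. Qed.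

Lemma incomparable_size u v : size u = size v -> u != v -> incomparable u v.
Proof.
move=> uv ne; rewrite /incomparable !prefixE {1}uv -{2}uv !take_size.
by rewrite eq_sym ne.
Qed.

End Words.

(** * Elements of the group and the cones they map onto cones *)

Section Cones.
Variable n : nat.
Hypothesis n_gt1 : (1 < n)%N.
Implicit Types (u v w z : seq 'I_n) (x y p : cantor n) (f : cantor n -> cantor n).

Definition letter0 : 'I_n := Ordinal (ltnW n_gt1).
Definition letter1 : 'I_n := Ordinal n_gt1.

Definition words k : seq (seq 'I_n) := [seq tval t | t <- enum {:k.-tuple 'I_n}].

Lemma mem_words k u : (u \in words k) = (size u == k).
Proof.
apply/mapP/eqP => [[t _ ->]|uk]; first exact: size_tuple.
by move: u uk => u <-; exists (in_tuple u); rewrite ?mem_enum.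
Qed.

Lemma begins_rcons u a x :
  begins (rcons u a) x = begins u x && (x (size u) == a).
Proof. by rewrite /begins size_rcons pfxS eqseq_rcons. Qed.

Lemma open_begins u : open [set x | begins u x].
Proof.
elim/last_ind: u => [|u a IH].
  by rewrite (_ : [set _ | _] = setT) ; [exact: openT | apply/seteqP; split].
rewrite (_ : [set _ | _] = [set x | begins u x] `&`
    proj (size u) @^-1` [set a : discrete_topology 'I_n]); last first.
  apply/seteqP; split=> x /=; rewrite begins_rcons; first by case/andP=> -> /eqP.
  by case=> -> /eqP.
apply: openI => //; apply: open_comp => [x _|]; first exact: proj_continuous.
exact: discrete_open.
Qed.

Lemma clopen_begins u : clopen [set x | begins u x].
Proof.
split; first exact: open_begins.
rewrite -openC (_ : ~` _ =
    \bigcup_(v in [set v | size v = size u /\ v <> u]) [set x | begins v x]).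
  by apply: bigcup_open => v _; exact: open_begins.
apply/seteqP; split=> x /=.
  move=> xu; exists (pfx (size u) x) => /=; last exact: begins_pfx.
  by split; [exact: size_pfx | move=> e; apply: xu; rewrite /begins e].
case=> v /= [vu ne] /eqP xv; apply/negP; apply/eqP => xu.
by apply: ne; rewrite -xv vu.
Qed.

(** Prefix replacement read on long words rather than on a finite table; in this
    form it makes sense for a map not yet known to be a homeomorphism. *)
Definition locally_prefix f :=
  exists k, forall u, (k <= size u)%N ->
    exists w, forall x, f (prepend u x) = prepend w x.

Lemma locally_prefix_near f x k : locally_prefix f ->
  exists l, forall y, pfx l x = pfx l y -> pfx k (f x) = pfx k (f y).
Proof.
case=> l fP; exists (l + k)%N => y xy; have [] := fP (pfx l x).
  by rewrite size_pfx.
move=> w fw; rewrite -(pfxK l x) -(pfxK l y) fw.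
rewrite -(pfx_le (leq_addr _ _) xy) fw; apply/pfx_eqP => i ik.
have [iw|wi] := ltnP i (size w).
  by rewrite !prepend_lt //; exact: set_nth_default.
rewrite !prepend_ge // /shift; move/pfx_eqP: xy; apply.
by rewrite ltn_add2l (leq_ltn_trans (leq_subr _ _)).
Qed.

Lemma locally_prefix_continuous f : locally_prefix f -> continuous f.
Proof.
move=> fP x; have FF : Filter (f @ x) by exact: (fmap_filter f (nbhs_filter x)).
have [_] := @cvg_sup (cantor n) nat (fun i => Topological.class
  (initial_topology (fun g : nat -> discrete_topology 'I_n => g i))) (f @ x) (f x) FF.
apply=> i A /= [B [[C _ <-] Cfx] BA].
have [l fl] := locally_prefix_near x i.+1 fP.
apply: (@filterS _ (nbhs x) _ [set y | begins (pfx l x) y]).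
  move=> y /eqP; rewrite size_pfx => xy; apply: BA => /=.
  by have /pfx_eqP <- := fl _ (esym xy).
by apply: open_nbhs_nbhs; split; [exact: open_begins|exact: begins_pfx].
Qed.

Lemma locally_prefix_replacement (g : homeo (cantor n)) :
  locally_prefix g -> prefix_replacement g.
Proof.
case=> k gk; have /choice[r rP] : forall u, exists w, size u = k ->
    forall x, g (prepend u x) = prepend w x.
  move=> u; have [uk|ne] := eqVneq (size u) k; last by exists u => /eqP;
    rewrite (negPf ne).
  by have [] := gk u; [rewrite uk | move=> w gu; exists w].
exists [seq (u, r u) | u <- words k]; split=> [x|p].
  exists (pfx k x, r (pfx k x)); last by exists (shift k x); rewrite pfxK.
  by apply/mapP; exists (pfx k x); rewrite // mem_words size_pfx.
by case/mapP => u; rewrite mem_words => /eqP uk -> y /=; exact: rP.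
Qed.

Lemma prefix_replacement_locally (g : homeo (cantor n)) :
  prefix_replacement g -> locally_prefix g.
Proof.
case=> s [cover gs]; exists (\max_(p <- s) size p.1)%N => u su.
pose x0 : cantor n := fun _ => letter0.
have [p ps [y xy]] := cover (prepend u x0).
have pu : (size p.1 <= size u)%N.
  apply: leq_trans su. exact (@leq_bigmax_seq _ s xpredT (fun p : seq (ordinal n) *
    seq (ordinal n) => size p.1) p ps isT).
have -> : u = p.1 ++ drop (size p.1) u by exact: prepend_prefix pu (esym xy).
exists (p.2 ++ drop (size p.1) u) => x.
by rewrite !prepend_cat gs.
Qed.

Local Open Scope group_scope.
Implicit Types g h : higman_thompson n.

Lemma ht_mulE g h x : (g * h) x = g (h x). Proof. by []. Qed.
Lemma ht_invK g x : g^-1 (g x) = x. Proof. exact: (homeo_funK g). Qed.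
Lemma ht_invVK g x : g (g^-1 x) = x. Proof. exact: (homeo_invK g). Qed.

Lemma ht_ext g h : (forall x, g x = h x) -> g = h.
Proof. by move=> gh; apply/val_inj/homeoP. Qed.

Lemma ht_local g : locally_prefix g.
Proof. by apply: prefix_replacement_locally; apply/asboolP; exact: (valP g). Qed.

Lemma ht_near g x k :
  exists l, forall y, pfx l x = pfx l y -> pfx k (g x) = pfx k (g y).
Proof. exact/locally_prefix_near/ht_local. Qed.

(** Prefix replacement implies continuity, so that an element of the group can be
    given by two mutually inverse maps of this kind. *)
Lemma ht_build f f' : locally_prefix f -> locally_prefix f' ->
  cancel f f' -> cancel f' f -> exists g, forall x, g x = f x.
Proof.
move=> fP f'P fK f'K.
pose g := Homeo (locally_prefix_continuous fP) (locally_prefix_continuous f'P) fK f'K.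
have gP : g \in @prefix_replacement_pred n.
  by apply/asboolP/locally_prefix_replacement.
by exists (HigmanThompson gP).
Qed.

Definition maps g u v := forall x, g (prepend u x) = prepend v x.

Lemma mapsM g h u v w : maps g v w -> maps h u v -> maps (g * h) u w.
Proof. by move=> gP hP x; rewrite ht_mulE hP gP. Qed.

Lemma mapsV g u v : maps g u v -> maps g^-1 v u.
Proof. by move=> gP x; rewrite -gP ht_invK. Qed.

Lemma maps_cat g u v z : maps g u v -> maps g (u ++ z) (v ++ z).
Proof. by move=> gP x; rewrite !prepend_cat gP. Qed.

Definition other (a : 'I_n) : 'I_n := if a == letter0 then letter1 else letter0.

Lemma other_neq a : other a != a.
Proof. by rewrite /other; have [->|] := eqVneq a letter0; rewrite // eq_sym. Qed.

Lemma prepend_nontrivial z : z != [::] -> exists x, prepend z x <> x.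
Proof.
case: z => // a z _; exists (fun _ => other a) => /(congr1 (fun x : cantor n => x
  0%N)).
by move=> /esym/eqP; rewrite (negPf (other_neq a)).
Qed.

(** The word is determined by the image cone and the parametrisation of it: if v'
    were v followed by z, then prepending z would be the identity, whereas a cone
    is not a single point. *)
Lemma maps_fun g u v v' : maps g u v -> maps g u v' -> v = v'.
Proof.
wlog vv' : v v' / (size v <= size v')%N => [th|] gv gv'.
  by have [l|/ltnW l] := leqP (size v) (size v'); [|symmetry]; exact: th.
have e x : prepend v x = prepend v' x by rewrite -gv gv'.
have v'E := prepend_prefix vv' (e (fun _ => letter0)).
have [z0|/prepend_nontrivial[x]] := eqVneq (drop (size v) v') [::].
  by rewrite v'E z0 cats0.
by case; apply: (@prepend_inj _ v); rewrite -prepend_cat -v'E e.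
Qed.

Lemma maps_begins g u v x : maps g u v -> begins v (g x) = begins u x.
Proof.
move=> gP; apply/idP/idP => [/beginsP[y gxy]|/beginsP[y ->]].
  by rewrite -(ht_invK g x) gxy (mapsV gP) begins_prepend.
by rewrite gP begins_prepend.
Qed.

Lemma maps_incomparable g u v u' v' : maps g u u' -> maps g v v' ->
  incomparable u v -> incomparable u' v'.
Proof.
move=> gu gv uv; apply: incomparable_disjoint; first exact: ltnW.
move=> x; rewrite -(ht_invVK g x) (maps_begins _ gu) (maps_begins _ gv).
exact: incomparable_begins.
Qed.

Lemma maps_dom g : exists k, forall u, (k <= size u)%N -> exists v, maps g u v.
Proof. exact: ht_local. Qed.

End Cones.

(** * Three-cycles of cones *)

Section ThreeCycles.
Local Open Scope group_scope.
Variable n : nat.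
Hypothesis n_gt1 : (1 < n)%N.
Implicit Types (a b c d e u v w z : seq 'I_n) (x y p : cantor n).
Implicit Types g h k t : higman_thompson n.

Definition three_cycle h u v w :=
  [/\ incomparable u v, incomparable v w & incomparable w u] /\
  [/\ maps h u v, maps h v w, maps h w u &
      forall x, ~~ begins u x -> ~~ begins v x -> ~~ begins w x -> h x = x].

Lemma begins_prependE u v x : (size u <= size v)%N ->
  begins u (prepend v x) = prefix u v.
Proof.
move=> uv; apply/idP/idP => [ux|p].
  exact: begins_comparable ux (begins_prepend v x) uv.
exact: begins_prefix p (begins_prepend v x).
Qed.

Let rot u v w x : cantor n :=
  if begins u x then prepend v (shift (size u) x)
  else if begins v x then prepend w (shift (size v) x)
  else if begins w x then prepend u (shift (size w) x) else x.

Let shift_prepend u x : shift (size u) (prepend u x) = x.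
Proof. by apply: (@prepend_inj _ u); rewrite -{1}(pfx_prepend u x) pfxK. Qed.

Let rotP u v w : incomparable u v -> incomparable v w -> incomparable w u ->
  [/\ forall x, rot u v w (prepend u x) = prepend v x,
      forall x, rot u v w (prepend v x) = prepend w x,
      forall x, rot u v w (prepend w x) = prepend u x &
      forall x, ~~ begins u x -> ~~ begins v x -> ~~ begins w x -> rot u v w x = x].
Proof.
move=> uv vw wu; split=> x; rewrite /rot.
- by rewrite begins_prepend shift_prepend.
- rewrite begins_prepend shift_prepend; rewrite incomparableC in uv.
  by rewrite (negPf (incomparable_begins uv (begins_prepend v x))).
- rewrite begins_prepend shift_prepend; rewrite incomparableC in vw.
  rewrite (negPf (incomparable_begins wu (begins_prepend w x))).
  by rewrite (negPf (incomparable_begins vw (begins_prepend w x))).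
- by move=> /negPf -> /negPf -> /negPf ->.
Qed.

Let rot_local u v w : incomparable u v -> incomparable v w -> incomparable w u ->
  locally_prefix (rot u v w).
Proof.
move=> uv vw wu; have [ru rv rw r0] := rotP uv vw wu.
exists (maxn (size u) (maxn (size v) (size w))) => t.
rewrite !geq_max => /and3P[ut vt wt].
have [/prefixP[z ->]|nu] := boolP (prefix u t).
  by exists (v ++ z) => x; rewrite !prepend_cat ru.
have [/prefixP[z ->]|nv] := boolP (prefix v t).
  by exists (w ++ z) => x; rewrite !prepend_cat rv.
have [/prefixP[z ->]|nw] := boolP (prefix w t).
  by exists (u ++ z) => x; rewrite !prepend_cat rw.
by exists t => x; rewrite r0 // begins_prependE.
Qed.

Let rotK u v w : incomparable u v -> incomparable v w -> incomparable w u ->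
  cancel (rot u v w) (rot w v u).
Proof.
move=> uv vw wu x; have [ru rv rw r0] := rotP uv vw wu.
have C a b : incomparable a b -> incomparable b a by rewrite incomparableC.
have [sw sv su s0] := rotP (C _ _ vw) (C _ _ uv) (C _ _ wu).
have [/beginsP[y ->]|nu] := boolP (begins u x); first by rewrite ru sv.
have [/beginsP[y ->]|nv] := boolP (begins v x); first by rewrite rv sw.
have [/beginsP[y ->]|nw] := boolP (begins w x); first by rewrite rw su.
by rewrite r0 // s0.
Qed.

Lemma three_cycle_exists u v w :
  incomparable u v -> incomparable v w -> incomparable w u ->
  exists h, three_cycle h u v w.
Proof.
move=> uv vw wu.
have vu : incomparable v u by rewrite incomparableC.
have wv : incomparable w v by rewrite incomparableC.
have uw : incomparable u w by rewrite incomparableC.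
have [h hE] := ht_build (rot_local uv vw wu) (rot_local wv vu uw)
  (rotK uv vw wu) (rotK wv vu uw).
exists h; split=> //; have [ru rv rw r0] := rotP uv vw wu.
by split=> x *; rewrite hE; auto.
Qed.

Lemma three_cycleC h u v w : three_cycle h u v w -> three_cycle h v w u.
Proof. by case=> -[? ? ?] [? ? ? h0]; do 2!split=> //; move=> x *; exact: h0. Qed.

Lemma three_cycleV h u v w : three_cycle h u v w -> three_cycle h^-1 w v u.
Proof.
case=> -[uv vw wu] [hu hv hw h0]; split; first by split; rewrite incomparableC.
split; try exact: mapsV.
by move=> x wx vx ux; rewrite -{1}(h0 x ux vx wx) ht_invK.
Qed.

Lemma three_cycle_fix h u v w a : three_cycle h u v w ->
  incomparable a u -> incomparable a v -> incomparable a w -> maps h a a.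
Proof.
case=> _ [_ _ _ h0] au av aw x; have ax := begins_prepend a x.
by apply: h0; [exact: incomparable_begins au ax|exact: incomparable_begins av ax|
  exact: incomparable_begins aw ax].
Qed.

Lemma three_cycle_eq h k u v w :
  three_cycle h u v w -> maps k u v -> maps k v w -> maps k w u ->
  (forall x, ~~ begins u x -> ~~ begins v x -> ~~ begins w x -> k x = x) -> h = k.
Proof.
move=> [_ [hu hv hw h0]] ku kv kw k0; apply: ht_ext => x.
have [/beginsP[y ->]|nu] := boolP (begins u x); first by rewrite hu ku.
have [/beginsP[y ->]|nv] := boolP (begins v x); first by rewrite hv kv.
have [/beginsP[y ->]|nw] := boolP (begins w x); first by rewrite hw kw.
by rewrite h0 // k0.
Qed.

Lemma three_cycle_conj g h u v w u' v' w' :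
  maps g u u' -> maps g v v' -> maps g w w' ->
  three_cycle h u v w -> three_cycle (g * h * g^-1) u' v' w'.
Proof.
move=> gu gv gw [[uv vw wu] [hu hv hw h0]]; split.
  by split; [exact: maps_incomparable gu gv uv|exact: maps_incomparable gv gw vw|
    exact: maps_incomparable gw gu wu].
split; try by apply: mapsM; [|exact: mapsV]; apply: mapsM.
move=> x ux vx wx; rewrite !ht_mulE h0 ?ht_invVK //.
- by rewrite -(maps_begins _ gu) ht_invVK.
- by rewrite -(maps_begins _ gv) ht_invVK.
- by rewrite -(maps_begins _ gw) ht_invVK.
Qed.

(** Two three-cycles of five disjoint cones that share one cone have a three-cycle
    as commutator, as in the alternating group on five letters. *)
Lemma three_cycle_commutator g h a b c d e :
  pairwise (@incomparable n) [:: a; b; c; d; e] ->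
  three_cycle g d a c -> three_cycle h c e b -> three_cycle [~ g, h] a b c.
Proof.
rewrite /= !andbT => /and4P[/and4P[ab ac ad ae] /and3P[bc bd be] /andP[cd ce] de] gP
  hP.
have C u v : incomparable u v -> incomparable v u by rewrite incomparableC.
have [_ [gd ga gc g0]] := gP; have [_ [hc he hb h0]] := hP.
have gb : maps g b b by apply: three_cycle_fix gP _ _ _ => //; exact: C.
have ge : maps g e e by apply: three_cycle_fix gP _ _ _; exact: C.
have ha : maps h a a by exact: three_cycle_fix hP _ _ _.
have hd : maps h d d by apply: three_cycle_fix hP _ _ _ => //; exact: C.
have V u v k : maps k u v -> maps k^-1 v u := @mapsV _ k u v.
have M u v w k t := @mapsM _ k t u v w.
have -> : [~ g, h] = g^-1 * (h^-1 * (g * h)) by [].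
split; first by split=> //; exact: C.
split.
- exact (M _ _ _ _ _ (V _ _ _ gb) (M _ _ _ _ _ (V _ _ _ hb) (M _ _ _ _ _ ga ha))).
- exact (M _ _ _ _ _ (V _ _ _ gc) (M _ _ _ _ _ (V _ _ _ hd) (M _ _ _ _ _ gc hb))).
- exact (M _ _ _ _ _ (V _ _ _ ga) (M _ _ _ _ _ (V _ _ _ hc) (M _ _ _ _ _ ge hc))).
move=> x ax bx cx; rewrite !ht_mulE.
have [/beginsP[y ->]|dx] := boolP (begins d x).
  exact (M _ _ _ _ _ (V _ _ _ gd) (M _ _ _ _ _ (V _ _ _ ha) (M _ _ _ _ _ gd hd)) y).
have [/beginsP[y ->]|ex] := boolP (begins e x).
  exact (M _ _ _ _ _ (V _ _ _ ge) (M _ _ _ _ _ (V _ _ _ he) (M _ _ _ _ _ gb he)) y).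
have gx : g x = x by exact: g0. have hx : h x = x by exact: h0.
by rewrite hx gx -{1}hx ht_invK -{1}gx ht_invK.
Qed.

End ThreeCycles.

(** * Alternating subgroups *)

Section Subgroups.
Local Open Scope group_scope.
Variables (G : groupType) (H : set G).
Hypothesis HG : is_subgroup H.

Lemma subgroup1 : H 1. Proof. by case: HG. Qed.

Lemma subgroupV x : H x -> H x^-1.
Proof. by case: HG => H1 HF Hx; rewrite -[x^-1]mul1g; exact: HF. Qed.

Lemma subgroupM x y : H x -> H y -> H (x * y).
Proof. by move=> Hx Hy; rewrite -[y]invgK; apply: HG.2 => //; exact: subgroupV. Qed.

End Subgroups.

Section Alternating.
Local Open Scope group_scope.
Variable n : nat.
Hypothesis n_gt1 : (1 < n)%N.
Implicit Types (a b : 'I_n) (c d e u v w z : seq 'I_n) (x y p : cantor n).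
Implicit Types g h k t : higman_thompson n.
Implicit Types E F : set (seq 'I_n).
Implicit Types M N : set (higman_thompson n).

Definition three_cycle_in E : set (higman_thompson n) :=
  [set h | exists u v w, three_cycle h u v w /\ [/\ E u, E v & E w]].

Definition alternating E : set (higman_thompson n) :=
  smallest (@is_subgroup _) (three_cycle_in E).

(** Sets of words closed under extension stand for the open subsets of the Cantor
    set, and [alternating E] for the alternating group of such a subset. *)
Definition extension_closed E := forall u z, E u -> E (u ++ z).

Definition cone u : set (seq 'I_n) := [set v | prefix u v].

Lemma cone_closed u : extension_closed (cone u).
Proof. by move=> v z /= uv; exact: prefix_catl. Qed.

Lemma alternating_subgroup E : is_subgroup (alternating E).
Proof.
split=> [M [MG _]|g h gE hE M [MG EM]]; first exact: subgroup1.
by apply: subgroupM => //; [exact: gE|apply: subgroupV => //; exact: hE].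
Qed.

Lemma alternating_min E M : is_subgroup M -> three_cycle_in E `<=` M ->
  alternating E `<=` M.
Proof. by move=> MG EM g; apply. Qed.

Lemma three_cycle_alternating E : three_cycle_in E `<=` alternating E.
Proof. by move=> h hE M [_]; apply. Qed.

Lemma three_cycle_inS E F : E `<=` F -> three_cycle_in E `<=` three_cycle_in F.
Proof. by move=> EF h [u [v [w [? [? ? ?]]]]]; exists u, v, w; split=> //; split;
  exact: EF. Qed.

Lemma three_cycle_inV E h : three_cycle_in E h -> three_cycle_in E h^-1.
Proof.
by move=> [u [v [w [hP [? ? ?]]]]]; exists w, v, u; split=> //; exact: three_cycleV.
Qed.

(** Cutting the three cones into the cones of their children writes a three-cycle
    as a product of commuting ones, one for each letter. *)
Lemma three_cycle_refine1 M h u v w : is_subgroup M -> three_cycle h u v w ->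
  (forall (a : 'I_n) t, three_cycle t (u ++ [:: a]) (v ++ [:: a]) (w ++ [:: a]) -> M
    t) ->
  M h.
Proof.
move=> MG hP MP; have [[uv vw wu] [hu hv hw h0]] := hP.
(* k is the part of the product that comes from the letters in s. *)
suff : forall s, uniq s -> exists2 k, M k & [/\
    forall a, a \in s -> [/\ maps k (u ++ [:: a]) (v ++ [:: a]),
      maps k (v ++ [:: a]) (w ++ [:: a]) & maps k (w ++ [:: a]) (u ++ [:: a])] &
    forall x, (forall a, a \in s -> [/\ ~~ begins (u ++ [:: a]) x,
      ~~ begins (v ++ [:: a]) x & ~~ begins (w ++ [:: a]) x]) -> k x = x].
  have split1 c x : prepend c x = prepend (c ++ [:: x 0%N]) (shift 1 x).
    by rewrite prepend_cat -{1}(pfxK 1 x).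
  move=> /(_ (enum 'I_n) (enum_uniq _)) [k Mk [kP k0]].
  have kPx x := kP (x 0%N) (mem_enum _ _).
  rewrite (three_cycle_eq (k := k) hP) // => x.
  - by have [e _ _] := kPx x; rewrite split1 e -split1.
  - by have [_ e _] := kPx x; rewrite split1 e -split1.
  - by have [_ _ e] := kPx x; rewrite split1 e -split1.
  move=> ux vx wx; apply: k0 => a _.
  by split; [move: ux|move: vx|move: wx]; apply: contra; exact: begins_catl.
elim=> [_|a s IH /= /andP[as_ us]]; first by exists 1; [exact: subgroup1|].
have [k Mk [kP k0]] := IH us.
have [t tP] : exists t, three_cycle t (u ++ [:: a]) (v ++ [:: a]) (w ++ [:: a]).
  by apply: three_cycle_exists => //; exact: incomparable_cat.
have [_ [tu tv tw t0]] := tP.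
have C c d : incomparable c d -> incomparable d c by rewrite incomparableC.
have diff c b : b != a -> incomparable (c ++ [:: b]) (c ++ [:: a]).
  by move=> ba; rewrite incomparable_cat2l; apply: incomparable_size => //;
    rewrite eqseq_cons andbT.
exists (t * k); first by apply: subgroupM => //; exact: MP tP.
split=> [b|x xP].
  rewrite inE; have [-> _|ba /= bs] := eqVneq b a.
    have kid c : c \in [:: u; v; w] -> maps k (c ++ [:: a]) (c ++ [:: a]).
      move=> cuvw x; apply: k0 => b' b's.
      have b'a : b' != a by apply: contraNneq as_ => <-.
      have cx := begins_prepend (c ++ [:: a]) x.
      by move: cuvw; rewrite !inE => /or3P[] /eqP ?; subst c; split;
        apply: incomparable_begins cx; first [exact/C/diff|
          by apply: incomparable_cat => //; exact: C].
    by split; apply: mapsM (kid _ _); rewrite ?inE ?eqxx ?orbT.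
  have tid c : c \in [:: u; v; w] -> maps t (c ++ [:: b]) (c ++ [:: b]).
    by rewrite !inE => /or3P[] /eqP ->; apply: three_cycle_fix tP _ _ _;
      first [exact: diff|by apply: incomparable_cat => //; exact: C].
  by have [? ? ?] := kP b bs; split; apply: mapsM (tid _ _) _;
    rewrite ?inE ?eqxx ?orbT.
have kx : k x = x.
  by apply: k0 => b bs; apply: xP; rewrite inE bs orbT.
by have [? ? ?] := xP a (mem_head _ _); rewrite ht_mulE kx t0.
Qed.

Lemma three_cycle_refine M l h u v w : is_subgroup M -> three_cycle h u v w ->
  (forall z t, size z = l -> three_cycle t (u ++ z) (v ++ z) (w ++ z) -> M t) -> M h.
Proof.
move=> MG; elim: l h u v w => [|l IH] h u v w hP MP.
  by apply: (MP [::]) => //; rewrite !cats0.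
apply: (three_cycle_refine1 MG hP) => a t tP; apply: IH tP _ => z k zl kP.
by apply: (MP (a :: z)); rewrite /= ?zl // -!(catA _ [:: a]) in kP *.
Qed.

Lemma alternating_refine E M l : extension_closed E -> is_subgroup M ->
  (forall h u v w, three_cycle h u v w -> [/\ E u, E v & E w] ->
    [/\ (l <= size u)%N, (l <= size v)%N & (l <= size w)%N] -> M h) ->
  alternating E `<=` M.
Proof.
move=> Ecl MG MP; apply: alternating_min => // h [u [v [w [hP [Eu Ev Ew]]]]].
apply: (three_cycle_refine (l := l)) hP _ => // z t zl tP.
by apply: MP tP _ _; split; rewrite ?size_cat ?zl ?leq_addl //; exact: Ecl.
Qed.

Lemma other_incomparable u (a : 'I_n) :
  incomparable (u ++ [:: other n_gt1 a]) (u ++ [:: a]).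
Proof.
rewrite incomparable_cat2l; apply: incomparable_size => //.
by rewrite eqseq_cons andbT other_neq.
Qed.

(** Once refined to children, a three-cycle leaves room for two further cones
    next to it, those of other children, and becomes a commutator. *)
Lemma alternating_perfect E M : extension_closed E -> is_subgroup M ->
  (forall g h, three_cycle_in E g -> three_cycle_in E h -> M [~ g, h]) ->
  alternating E `<=` M.
Proof.
move=> Ecl MG MP; apply: alternating_min => // k [u [v [w [kP [Eu Ev Ew]]]]].
have [[uv vw wu] _] := kP; apply: (three_cycle_refine1 MG kP) => a t tP.
have C c d : incomparable c d -> incomparable d c by rewrite incomparableC.
have vu := C _ _ uv; have wv := C _ _ vw; have uw := C _ _ wu.
have ii s : incomparable (s ++ [:: a]) (s ++ [:: other n_gt1 a]).
  exact/C/other_incomparable.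
have inc : pairwise (@incomparable n) [:: u ++ [:: a]; v ++ [:: a]; w ++ [:: a];
    u ++ [:: other n_gt1 a]; v ++ [:: other n_gt1 a]].
  by rewrite /= ?andbT !ii !(incomparable_cat _ _ uv, incomparable_cat _ _ vu,
    incomparable_cat _ _ uw, incomparable_cat _ _ wu, incomparable_cat _ _ vw,
    incomparable_cat _ _ wv).
move: (inc); rewrite /= !andbT => /and4P[/and4P[ab ac ad ae] /and3P[bc bd be]
  /andP[cd ce] de].
have [g gP] := three_cycle_exists (C _ _ ad) ac cd.
have [h hP] := three_cycle_exists ce (C _ _ be) bc.
have [_ [tu tv tw t0]] := tP; have cP := three_cycle_commutator inc gP hP.
have [_ [? ? ? ?]] := cP; rewrite (three_cycle_eq (k := [~ g, h]) tP) //.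
apply: MP; first by exists (u ++ [:: other n_gt1 a]), (u ++ [:: a]), (w ++ [:: a]);
  split=> //; split; exact: Ecl.
by exists (w ++ [:: a]), (v ++ [:: other n_gt1 a]), (v ++ [:: a]);
  split=> //; split; exact: Ecl.
Qed.

(** ** Supports *)

Definition supported E g := forall x, g x <> x -> exists2 e, E e & begins e x.

Lemma supported_subgroup E : is_subgroup (supported E).
Proof.
split=> [x //|g h gE hE x]; rewrite ht_mulE.
have [hx|hx _] := pselect (h x = x); last exact: hE.
have -> : h^-1 x = x by rewrite -{1}hx ht_invK.
exact: gE.
Qed.

Lemma alternating_supported E : alternating E `<=` supported E.
Proof.
apply: alternating_min; first exact: supported_subgroup.
move=> h [u [v [w [[_ [_ _ _ h0]] [Eu Ev Ew]]]]] x hx.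
have [ux|nu] := boolP (begins u x); first by exists u.
have [vx|nv] := boolP (begins v x); first by exists v.
have [wx|nw] := boolP (begins w x); first by exists w.
by case: hx; exact: h0.
Qed.

Lemma supported_commute E F g h : supported E g -> supported F h ->
  (forall u v, E u -> F v -> incomparable u v) -> g * h = h * g.
Proof.
move=> gE hF EF; apply: ht_ext => x; rewrite !ht_mulE.
have fixh y : g y <> y -> h y = y.
  move=> /gE[e Ee ey]; apply: contrapT => /hF[f Ff fy].
  by have := incomparable_begins (EF _ _ Ee Ff) ey; rewrite fy.
have fixg y : h y <> y -> g y = y.
  by move=> hy; apply: contrapT => /fixh.
have gI := can_inj (ht_invK g); have hI := can_inj (ht_invK h).
have [gx|gx] := pselect (g x = x); last by rewrite (fixh x gx) fixh // => /gI.
have [hx|hx] := pselect (h x = x); first by rewrite hx gx hx.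
by rewrite gx fixg // => /hI.
Qed.

End Alternating.

(** * Normal closures and generation *)

Section Generation.
Local Open Scope group_scope.
Variable n : nat.
Hypothesis n_gt1 : (1 < n)%N.
Implicit Types (a b : 'I_n) (c d e f u v w z : seq 'I_n) (x y p : cantor n).
Implicit Types g h k t : higman_thompson n.
Implicit Types E F : set (seq 'I_n).
Implicit Types M N : set (higman_thompson n).

Let o := letter0 n_gt1.
Let i1 := letter1 n_gt1.

Lemma three_cycle_uniq h k u v w :
  three_cycle h u v w -> three_cycle k u v w -> h = k.
Proof. by move=> hP [_ [? ? ? ?]]; exact: three_cycle_eq hP _ _ _ _. Qed.

(** Each word of s is avoided by spending one letter, which is possible as long as
    the words of s are long enough to be compared at that place. *)
Lemma exists_incomparable_extension c (s : seq (seq 'I_n)) :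
  (forall w, w \in s -> (size c + size s <= size w)%N) ->
  exists z, forall w, w \in s -> incomparable (c ++ z) w.
Proof.
elim: s c => [|w s IH] c cs; first by exists [::].
have cw := cs w (mem_head _ _); rewrite /= addnS in cw.
have [a aw] : exists a, incomparable (c ++ [:: a]) w.
  have [/prefixP[[|a z] wE]|ncw] := boolP (prefix c w).
  - by rewrite wE size_cat /= addn0 ltnNge leq_addr in cw.
  - exists (other n_gt1 a); rewrite wE -(cat1s a z) catA.
    exact/incomparable_catr/other_incomparable.
  - exists o; apply: incomparable_catl; rewrite /incomparable ncw.
    by apply/negP => /size_prefix; rewrite leqNgt (leq_ltn_trans (leq_addr (size s)
      _)).
have [w' w's|z zP] := IH (c ++ [:: a]).
  have := cs w'; rewrite inE w's orbT => /(_ isT) /=.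
  by rewrite size_cat addn1 addnS addSn.
exists (a :: z) => w'; rewrite inE -(cat1s a z) catA => /predU1P[->|]; last exact: zP.
exact: incomparable_catl.
Qed.

(** An infinite antichain: any cone contains arbitrarily many disjoint cones. *)
Definition unary (j : nat) : seq 'I_n := nseq j i1 ++ [:: o].

Lemma unary_incomparable j l : j != l -> incomparable (unary j) (unary l).
Proof.
wlog jl : j l / (j < l)%N => [th|_].
  rewrite neq_ltn => /orP[] jl; last rewrite incomparableC;
  by apply: th => //; rewrite neq_ltn jl.
have [r ->] : exists r : nat, l = (j + r.+1)%N.
  by exists (l - j.+1)%N; rewrite addnS -addSn subnKC.
rewrite /unary nseqD -catA incomparable_cat2l -[nseq _.+1 _]cat1s -catA.
by apply: incomparable_catr; exact: incomparable_size.
Qed.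

(** The element x q, where q is a conjugate of x^-1, belongs to N, and it has the
    same commutator with y as x because q commutes with both. *)
Lemma commutator_in_normalised (G : groupType) (N : set G) (m x y : G) :
  is_subgroup N -> N m ->
  (forall s, N s -> N (x * s * x^-1)) -> (forall s, N s -> N (y^-1 * s * y)) ->
  let q := m * x^-1 * m^-1 in q * x = x * q -> q * y = y * q -> N [~ x, y].
Proof.
move=> NG Nm Nx Ny q qx qy.
have Np : N (x * q).
  by rewrite /q !mulgA; apply: subgroupM => //; [exact: Nx | exact: subgroupV].
have -> : [~ x, y] = (x * q)^-1 * (y^-1 * (x * q) * y).
  by clearbody q; rewrite commgEl conjgE -qx invgM !mulgA -(mulgA _ y^-1 q)
    -(commuteV qy) !mulgA mulgVK.
exact: (subgroupM NG (subgroupV NG Np) (Ny _ Np)).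
Qed.

(** The element g pushes a cone c strictly into itself, so that all its positive
    powers move one fixed child A of c off itself. If N contains such a power, then
    it contains the commutators of elements supported in A, by
    [commutator_in_normalised], hence [alternating A] by perfectness; a conjugation
    brings any three small cones of E into A. *)
Lemma normal_closure E e : extension_closed E -> E e ->
  exists2 g, alternating E g & forall N (r : nat), is_subgroup N ->
    (forall t h, three_cycle_in E t -> N h -> N (t * h * t^-1)) ->
    (0 < r)%N -> N (g ^+ r) -> alternating E `<=` N.
Proof.
move=> Ecl Ee.
have inc (s t : seq 'I_n) : size s = size t -> s != t ->
    incomparable (e ++ s) (e ++ t).
  by move=> st ne; rewrite incomparable_cat2l; exact: incomparable_size.
(* g is the product of the three-cycles (c d d') and (d co f); it maps c to co. *)
pose c := e ++ [:: o; o]; pose d := e ++ [:: o; i1].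
pose d' := e ++ [:: i1; o]; pose f := e ++ [:: i1; i1].
have Ed : E d by exact: Ecl.
have [t1 t1P] : exists t, three_cycle t c d d' by apply: three_cycle_exists;
  exact: inc.
have [t2 t2P] : exists t, three_cycle t d (c ++ [:: o]) f.
  apply: three_cycle_exists; [apply: incomparable_catr|apply: incomparable_catl|];
    exact: inc.
exists (t2 * t1).
  apply: (subgroupM (alternating_subgroup E)).
    apply: three_cycle_alternating; exists d, (c ++ [:: o]), f; split=> //.
    by split; rewrite /c -?catA; exact: Ecl.
  by apply: three_cycle_alternating; exists c, d, d'; split=> //; split; exact: Ecl.
move=> N k NG Nconj k0.
have : forall j, maps ((t2 * t1) ^+ j) c (c ++ nseq j o).
  have gc : maps (t2 * t1) c (c ++ [:: o]).
    by have [_ [_ h2 _ _]] := t1P; case: t2P => _ [h1 _ _ _] x;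
      case: t1P => _ [h3 _ _ _]; exact: (mapsM h1 h3).
  elim=> [|j IH]; first by rewrite cats0.
  rewrite expgS; apply: mapsM IH; rewrite /= -cat1s catA; exact: maps_cat.
move=> /(_ k); set m := _ ^+ k => mc Nm.
pose A := cone (c ++ [:: i1]).
have AE : A `<=` E by move=> _ /prefixP[z ->]; rewrite /c -!catA; exact: Ecl.
have conjV t h : three_cycle_in E t -> N h -> N (t^-1 * h * t).
  by move=> tE Nh; rewrite -{2}[t]invgK; apply: Nconj => //; exact: three_cycle_inV.
have AN : alternating A `<=` N.
  apply: (alternating_perfect n_gt1 (@cone_closed _ _) NG) => g h gA hA.
  have gE := three_cycle_inS AE gA; have hE := three_cycle_inS AE hA.
  have qP : supported (cone (c ++ nseq k o ++ [:: i1])) (m * g^-1 * m^-1).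
    have [u [v [w [gP [Au Av Aw]]]]] := three_cycle_inV gA.
    have mA s : A s -> exists2 s', cone (c ++ nseq k o ++ [:: i1]) s' & maps m s s'.
      move=> /prefixP[z ->]; exists (c ++ nseq k o ++ [:: i1] ++ z).
        by apply/prefixP; exists z; rewrite -!catA.
      by rewrite -catA [c ++ nseq k o ++ _]catA; exact: maps_cat.
    have [u' Au' mu] := mA u Au; have [v' Av' mv] := mA v Av;
      have [w' Aw' mw] := mA w Aw.
    apply: (alternating_supported (three_cycle_alternating _)).
    exists u', v', w'; split=> //; exact (three_cycle_conj n_gt1 mu mv mw gP).
  have disj u v : cone (c ++ nseq k o ++ [:: i1]) u -> A v -> incomparable u v.
    move=> /prefixP[z ->] /prefixP[z' ->]; apply: incomparable_cat.
    rewrite incomparable_cat2l; by case: k k0 {mc Nm qP} m.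
  have sg := alternating_supported (three_cycle_alternating gA).
  have sh := alternating_supported (three_cycle_alternating hA).
  apply: (commutator_in_normalised NG Nm).
  - by move=> s Ns; exact: Nconj.
  - by move=> s Ns; exact: conjV.
  - exact: supported_commute qP sg disj.
  - exact: supported_commute qP sh disj.
(* Depth 3 below A leaves a cone of A away from any three given cones of depth l. *)
pose l := (size (c ++ [:: i1]) + 3)%N.
apply: (alternating_refine (l := l) Ecl NG) => h u v w hP [Eu Ev Ew] [lu lv lw].
have [z zP] : exists z, forall w', w' \in [:: u; v;
  w] -> incomparable ((c ++ [:: i1]) ++ z) w'.
  by apply: exists_incomparable_extension => w'; rewrite !inE => /or3P[] /eqP ->.
pose r j := ((c ++ [:: i1]) ++ z) ++ unary j.
have rE j : E (r j) by rewrite /r /c -!catA; exact: Ecl.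
have rA j : A (r j) by rewrite /A /r -catA /cone /= prefix_prefix.
have C s s' : incomparable s s' -> incomparable s' s by rewrite incomparableC.
have rr j j' : j != j' -> incomparable (r j) (r j').
  by move=> ne; rewrite incomparable_cat2l unary_incomparable.
have rs j s : s \in [:: u; v; w] -> incomparable (r j) s.
  by move=> /zP; exact: incomparable_catl.
have ex s j j' : s \in [:: u; v; w] -> j != j' ->
    exists2 t, three_cycle_in E t & three_cycle t s (r j) (r j').
  move=> suvw jj'; have [t tP] : exists t, three_cycle t s (r j) (r j').
    by apply: three_cycle_exists; [exact/C/rs|exact: rr|exact: rs].
  exists t => //; exists s, (r j), (r j'); split=> //; split=> //.
  by move: suvw; rewrite !inE => /or3P[] /eqP ->.
have [||tu tuE tuP] := ex u 0%N 1%N; rewrite ?inE ?eqxx //.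
have [||tv tvE tvP] := ex v 2%N 3%N; rewrite ?inE ?eqxx ?orbT //.
have [||tw twE twP] := ex w 4%N 5%N; rewrite ?inE ?eqxx ?orbT //.
have [[uv vw wu] _] := hP.
(* t carries u, v and w to three disjoint cones of A. *)
pose t := tu * (tv * tw).
have [_ [tu1 _ _ _]] := tuP; have [_ [tv1 _ _ _]] := tvP; have [_ [tw1 _ _ _]] := twP.
have fix_s s s' t' j j' : three_cycle t' s (r j) (r j') -> incomparable s' s ->
   s' \in [:: u; v; w] -> maps t' s' s'.
  by move=> t'P s's s'u; apply: three_cycle_fix t'P _ _ _ => //; exact/C/rs.
have fix_r s t' j j' j'' : three_cycle t' s (r j) (r j') -> s \in [:: u; v; w] ->
   j'' != j -> j'' != j' -> maps t' (r j'') (r j'').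
  by move=> t'P su ? ?; apply: three_cycle_fix t'P _ _ _;
    [exact: rs|exact: rr|exact: rr].
have Nt s : N (t * s * t^-1) -> N s.
  move=> Ns; have -> : s = tw^-1 * (tv^-1 * (tu^-1 * (t * s * t^-1) * tu) * tv) * tw.
    by rewrite /t !invgM -!mulgA !mulKg mulVg mulg1.
  exact: (conjV _ _ twE (conjV _ _ tvE (conjV _ _ tuE Ns))).
apply/Nt/AN; apply: three_cycle_alternating; exists (r 0%N), (r 2%N), (r 4%N);
  split=> //.
refine (three_cycle_conj n_gt1 _ _ _ hP).
- apply: mapsM tu1 _; apply: mapsM; first by apply: fix_s tvP _ _; rewrite ?inE ?eqxx.
  by apply: fix_s twP _ _; rewrite ?inE ?eqxx //; exact: C.
- apply: mapsM; first by apply: fix_r tuP _ _ _; rewrite ?inE ?eqxx.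
  by apply: mapsM tv1 _; apply: fix_s twP _ _; rewrite ?inE ?eqxx ?orbT.
- apply: mapsM; first by apply: fix_r tuP _ _ _; rewrite ?inE ?eqxx.
  by apply: mapsM _ tw1; apply: fix_r tvP _ _ _; rewrite ?inE ?eqxx ?orbT.
Qed.

Let C c d : incomparable c d -> incomparable d c.
Proof. by rewrite incomparableC. Qed.

(** A small three-cycle of cones in the union has two of its cones on the same
    side. The third one can be exchanged, on its own side, with a cone of the
    overlap, which conjugates the three-cycle into the other group. *)
Lemma alternating_overlap E F e M : extension_closed E -> extension_closed F ->
  E e -> F e -> is_subgroup M -> alternating E `<=` M -> alternating F `<=` M ->
  alternating (E `|` F) `<=` M.
Proof.
move=> Ecl Fcl Ee Fe MG EM FM.
have EFcl : extension_closed (E `|` F).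
  by move=> u z [/Ecl Eu|/Fcl Fu]; [left|right].
have core E1 E2 h u v w c d : alternating E1 `<=` M -> alternating E2 `<=` M ->
    three_cycle h u v w -> E1 u -> E1 v -> E2 w -> E1 c -> E2 c -> E2 d ->
    incomparable c d -> (forall s, s \in [:: u; v; w] ->
      incomparable c s /\ incomparable d s) -> M h.
  move=> E1M E2M hP E1u E1v E2w E1c E2c E2d cd cds; have [[uv vw wu] _] := hP.
  have [|cu du] := cds u; rewrite ?inE ?eqxx //.
  have [|cv dv] := cds v; rewrite ?inE ?eqxx ?orbT //.
  have [|cw dw] := cds w; rewrite ?inE ?eqxx ?orbT //.
  have [r rP] := three_cycle_exists (C cw) cd dw.
  have [t tP] := three_cycle_exists uv (C cv) cu.
  have Mr : M r by apply/E2M; apply: three_cycle_alternating; exists w, c, d.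
  have Mt : M t by apply/E1M; apply: three_cycle_alternating; exists u, v, c.
  have ru : maps r^-1 u u.
    by apply: mapsV; apply: three_cycle_fix rP _ _ _; exact: C.
  have rv : maps r^-1 v v.
    by apply: mapsV; apply: three_cycle_fix rP _ _ _ => //; exact: C.
  have rc : maps r^-1 c w by apply: mapsV; case: rP => _ [].
  rewrite (three_cycle_uniq hP (three_cycle_conj n_gt1 ru rv rc tP)) invgK.
  by apply: (subgroupM MG) => //; apply: (subgroupM MG) => //; exact: (subgroupV MG).
apply: (alternating_refine (l := (size e + 3)%N) EFcl MG).
move=> h u v w hP EFuvw [lu lv lw].
have [z zP] : exists z, forall s, s \in [:: u; v; w] -> incomparable (e ++ z) s.
  by apply: exists_incomparable_extension => s; rewrite !inE => /or3P[] /eqP ->.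
pose c := (e ++ z) ++ [:: o]; pose d := (e ++ z) ++ [:: i1].
have [Ec Ed Fc Fd] : [/\ E c, E d, F c & F d].
  by split; rewrite /c /d -catA; first [exact: Ecl|exact: Fcl].
have cd : incomparable c d by rewrite incomparable_cat2l; exact: incomparable_size.
have cds s : s \in [:: u; v; w] -> incomparable c s /\ incomparable d s.
  by move=> /zP ez; split; exact: incomparable_catl.
have cds1 s : s \in [:: v; w; u] -> incomparable c s /\ incomparable d s.
  by move=> suvw; apply: cds; move: suvw; rewrite !inE => /or3P[] ->; rewrite ?orbT.
have cds2 s : s \in [:: w; u; v] -> incomparable c s /\ incomparable d s.
  by move=> suvw; apply: cds1; move: suvw; rewrite !inE => /or3P[] ->; rewrite ?orbT.
have h1P := three_cycleC hP; have h2P := three_cycleC h1P.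
case: EFuvw => -[Eu|Fu] [Ev|Fv] [Ew|Fw].
- by apply/EM; apply: three_cycle_alternating; exists u, v, w.
- exact: (core E F h u v w c d).
- exact: (core E F h w u v c d).
- exact: (core F E h v w u c d).
- exact: (core E F h v w u c d).
- exact: (core F E h w u v c d).
- exact: (core F E h u v w c d).
- by apply/FM; apply: three_cycle_alternating; exists u, v, w.
Qed.

Let A : set (higman_thompson n) := alternating [set: seq 'I_n].

Let AG : is_subgroup A := alternating_subgroup _.

Let A3 h u v w : three_cycle h u v w -> A h.
Proof. by move=> hP; apply: three_cycle_alternating; exists u, v, w. Qed.

Lemma alternating_normal g h : A h -> A (g * h * g^-1).
Proof.
have [l gl] := maps_dom n_gt1 g; move: h.
apply: (@alternating_refine _ _ (fun h => A (g * h * g^-1)) l) => //.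
  split=> [|h k hA kA]; first by rewrite mulg1 mulgV; exact: subgroup1.
  have -> : g * (h * k^-1) * g^-1 = (g * h * g^-1) * (g * k * g^-1)^-1.
    by rewrite !invgM invgK !mulgA mulgVK.
  by apply: (subgroupM AG) => //; exact: (subgroupV AG).
move=> h u v w hP _ [/gl[u' gu] /gl[v' gv] /gl[w' gw]].
exact: A3 (three_cycle_conj n_gt1 gu gv gw hP).
Qed.

(** A family of disjoint cones outside c can be carried into c in a prescribed
    way; the images do not depend on the family, which allows to compose. *)
Let leg j c (us : seq (seq 'I_n)) : pairwise (@incomparable n) us ->
  (forall u, u \in us -> incomparable u c) ->
  exists2 t, A t &
    (forall r, (r < size us)%N ->
      maps t (nth [::] us r) (c ++ [:: o] ++ unary (j + r))) /\
    (forall u, (forall v, v \in us -> incomparable u v) ->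
      (forall r b, (j <= r)%N -> incomparable u (c ++ [:: b] ++ unary r)) ->
      maps t u u).
Proof.
elim: us j => [|u us IH] j /= => [_ _|/andP[/allP u_us us_i] usc].
  by exists 1; [exact: subgroup1 | split].
have [v vus|t At [tr t0]] := IH j.+1 us_i; first by apply: usc; rewrite inE vus orbT.
have uc := usc u (mem_head _ _).
pose v0 := c ++ [:: o] ++ unary j; pose v1 := c ++ [:: i1] ++ unary j.
have v01 : incomparable v0 v1.
  by rewrite incomparable_cat2l; apply: incomparable_cat; exact: incomparable_size.
have uv0 : incomparable u v0 by exact: incomparable_catr.
have uv1 : incomparable u v1 by exact: incomparable_catr.
have [k kP] := three_cycle_exists uv0 v01 (C uv1).
exists (k * t); first by apply: (subgroupM AG) => //; exact: A3 kP.
split=> [[_|r]|w wus wc].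
- rewrite /= addn0; have [_ [kuv _ _ _]] := kP; apply: mapsM kuv _.
  apply: t0 => [v vus|r b _]; [exact: u_us|exact: incomparable_catr].
- rewrite ltnS => rus; rewrite addnS -addSn /=; apply: mapsM (tr r rus).
  have ur : j != (j.+1 + r)%N by rewrite neq_ltn addSn ltnS leq_addr.
  apply: three_cycle_fix kP _ _ _; first exact/C/incomparable_catr.
    by rewrite !incomparable_cat2l unary_incomparable // eq_sym.
  by rewrite incomparable_cat2l; apply: incomparable_cat; exact: incomparable_size.
- have tw : maps t w w.
    apply: t0 => [v vus|r b jr]; first by apply: wus; rewrite inE vus orbT.
    by apply: wc; exact: ltnW.
  apply: mapsM tw; apply: three_cycle_fix kP _ _ _; [|exact: wc|exact: wc].
  by apply: wus; rewrite mem_head.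
Qed.

(** Both families are carried into a common cone z, through cones c' and d' that
    they leave free, and the two motions are compared there. *)
Lemma alternating_transport c d (us ws : seq (seq 'I_n)) : size us = size ws ->
  pairwise (@incomparable n) us -> pairwise (@incomparable n) ws ->
  (forall u, u \in us -> incomparable u c) ->
  (forall w, w \in ws -> incomparable w d) ->
  exists2 t, A t & forall r, (r < size us)%N -> maps t (nth [::] us r) (nth [::] ws
    r).
Proof.
move=> usz us_i ws_i usc wsd.
pose c' := c ++ [:: o; o]; pose d' := d ++ [:: o; o].
have [z zP] : exists z, forall w, w \in [:: c'; d'] -> incomparable ([::] ++ z) w.
  apply: exists_incomparable_extension => w; rewrite !inE.
  by case/orP => /eqP ->; rewrite size_cat /= leq_addl.
have [zc zd] : incomparable z c' /\ incomparable z d'.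
  by split; apply: zP; rewrite !inE eqxx ?orbT.
pose code e := [seq e ++ [:: o] ++ unary r | r <- iota 0 (size us)].
have code_i e : pairwise (@incomparable n) (code e).
  rewrite pairwise_map; apply/(pairwiseP 0%N) => r s;
    rewrite !inE !size_iota => rs ss lt.
  by rewrite !nth_iota //= !incomparable_cat2l; apply: unary_incomparable;
    rewrite neq_ltn lt.
have codez e : incomparable z e -> forall u, u \in code e -> incomparable u z.
  by move=> ze _ /mapP[r _ ->]; apply: incomparable_catl; exact: C.
have nth_code e r : (r < size us)%N -> nth [::] (code e) r = e ++ [:: o] ++ unary r.
  by move=> rs; rewrite (nth_map 0%N) ?size_iota // nth_iota.
have [u uus|t1 At1 [t1P _]] := @leg 0 c' us us_i; first exact/incomparable_catr/usc.
have [w wws|t2 At2 [t2P _]] := @leg 0 d' ws ws_i; first exact/incomparable_catr/wsd.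
have [|t3 At3 [t3P _]] := @leg 0 z (code c') (code_i _); first exact: codez.
have [|t4 At4 [t4P _]] := @leg 0 z (code d') (code_i _); first exact: codez.
exists ((t4 * t2)^-1 * (t3 * t1)).
  by apply: (subgroupM AG); [apply: (subgroupV AG)|]; exact: (subgroupM AG).
move=> r rs; have sc e : size (code e) = size us by rewrite size_map size_iota.
have := t3P r; rewrite sc nth_code // => /(_ rs) t3r.
have := t4P r; rewrite sc nth_code // => /(_ rs) t4r.
have t2r := t2P r; rewrite -usz in t2r.
exact (mapsM (mapsV (mapsM t4r (t2r rs))) (mapsM t3r (t1P r rs))).
Qed.

(** Away from c, the element g moves finitely many disjoint cones onto disjoint
    cones and leaves room on both sides, so it can be imitated in A. *)
Lemma alternating_agree g c : exists2 t, A t & forall x, ~~ begins c x -> t x = g x.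
Proof.
have [l gl] := maps_dom n_gt1 g.
have /choice[r rP] : forall u, exists v, (l <= size u)%N -> maps g u v.
  by move=> u; case: (leqP l (size u)) => [/gl[v gv]|_]; [exists v|exists u].
pose N := maxn l (size c).
pose us := [seq u <- words n N | ~~ prefix c u].
have usP u : u \in us -> size u = N /\ ~~ prefix c u.
  by rewrite mem_filter mem_words => /andP[? /eqP].
have gr u : u \in us -> maps g u (r u).
  by move=> /usP[uN _]; apply: rP; rewrite uN leq_maxl.
have us_i : pairwise (@incomparable n) us.
  have : uniq us by rewrite filter_uniq // map_inj_uniq ?enum_uniq //; exact: val_inj.
  rewrite uniq_pairwise; apply: (@sub_in_pairwise _ (mem us)); last exact/allP.
  move=> u v /usP[uN _] /usP[vN _] /=; apply: incomparable_size;
    exact: etrans (esym vN).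
have ws_i : pairwise (@incomparable n) (map r us).
  rewrite pairwise_map; apply: (@sub_in_pairwise _ (mem us)) us_i; last exact/allP.
  by move=> u v uus vus; exact: (maps_incomparable n_gt1 (gr u uus) (gr v vus)).
have gc : maps g (c ++ nseq l o) (r (c ++ nseq l o)).
  by apply: rP; rewrite size_cat size_nseq leq_addl.
have usc u : u \in us -> incomparable u c.
  move=> /usP[uN cu]; rewrite /incomparable cu andbT; apply: contra cu => uc.
  have := prefix_refl c; congr prefix; apply/eqP.
  move: uc; rewrite prefixE take_oversize ?uN ?leq_maxr //.
have [w /mapP[u uus ->]|t At tP] := @alternating_transport c (r (c ++ nseq l o))
    us (map r us) (esym (size_map r us)) us_i ws_i usc.
  by apply: (maps_incomparable n_gt1 (gr u uus) gc); apply: incomparable_catr;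
    exact: usc.
exists t => // x cx; have xus : pfx N x \in us.
  rewrite mem_filter mem_words size_pfx eqxx andbT; apply: contra cx => cx.
  exact: begins_prefix cx (begins_pfx N x).
have := tP (index (pfx N x) us); rewrite index_mem xus nth_index // => /(_ isT).
rewrite (nth_map [::]) ?index_mem // nth_index // => tx.
by rewrite -(pfxK N x) tx (gr _ xus).
Qed.

(** Modulo the normal subgroup A, every element is congruent to one supported in a
    cone chosen at will; two elements supported in disjoint cones commute. *)
Lemma derived_sub_alternating : derived_subgroup (higman_thompson n) `<=` A.
Proof.
have normal g h : A h -> A (g * h * g^-1) := @alternating_normal g h.
move=> z; apply; split=> // _ [g [h ->]].
have [t At tg] := alternating_agree g [:: o].
have [s As sh] := alternating_agree h [:: i1].
have supp (k q : higman_thompson n) c : (forall x, ~~ begins c x -> q x = k x) ->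
    supported [set c] (q^-1 * k).
  move=> qk x kx; exists c => //; apply: contrapT => /negP cx; apply: kx.
  by rewrite ht_mulE -qk // ht_invK.
have gh : (t^-1 * g) * (s^-1 * h) = (s^-1 * h) * (t^-1 * g).
  apply: supported_commute (supp _ _ _ tg) (supp _ _ _ sh) _ => u v /= -> ->.
  exact: incomparable_size.
set g' := t^-1 * g in gh; set h' := s^-1 * h in gh.
have gE : g = t * g' by rewrite mulVKg. have hE : h = s * h' by rewrite mulVKg.
clearbody g' h'.
pose n1 := t * (g' * s * g'^-1); pose n2 := s * (h' * t * h'^-1).
have An1 : A n1 by apply: (subgroupM AG) => //; exact: normal.
have An2 : A n2 by apply: (subgroupM AG) => //; exact: normal.
have e1 : g * h = n1 * (g' * h') by rewrite gE hE /n1 !mulgA mulgVK.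
have e2 : h * g = n2 * (g' * h') by rewrite gh gE hE /n2 !mulgA mulgVK.
clearbody n1 n2.
have -> : [~ g, h] = (g' * h')^-1 * (n2^-1 * n1) * (g' * h')^-1^-1.
  rewrite invgK -!mulgA -e1 mulgA -invgM -e2 invgM.
  by rewrite commgEl conjgE !mulgA.
by apply: normal; apply: (subgroupM AG) => //; exact: (subgroupV AG).
Qed.

End Generation.

(** * Germs and dynamics of a single element *)

Section Dynamics.
Local Open Scope group_scope.
Variable n : nat.
Hypothesis n_gt1 : (1 < n)%N.
Implicit Types (a b : 'I_n) (c d e f u v w z : seq 'I_n) (x y p q : cantor n).
Implicit Types (g h : higman_thompson n).

Definition locally_fixed g p := exists k, forall x, pfx k x = pfx k p -> g x = x.

(** The topological boundary of the set of fixed points of g. *)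
Definition frontier g p := g p = p /\ ~ locally_fixed g p.

Lemma locally_fixedM g h p :
  locally_fixed g p -> locally_fixed h p -> locally_fixed (g * h) p.
Proof.
move=> [k gk] [l hl]; exists (maxn k l) => x xp.
by rewrite ht_mulE hl ?gk //; apply: pfx_le xp; rewrite ?leq_maxl ?leq_maxr.
Qed.

Lemma locally_fixedV g p : locally_fixed g p -> locally_fixed g^-1 p.
Proof. by move=> [k gk]; exists k => x /gk gx; rewrite -{1}gx ht_invK. Qed.

(** Near a fixed point, g acts by shifting the indices of the far entries; the
    near entries are those of p. *)
Lemma germ_shift g p : g p = p -> exists l s, forall x, pfx l x = pfx l p ->
  forall i, g x i = if (i < s)%N then p i else x (i - s + l)%N.
Proof.
move=> gp; have [l gl] := maps_dom n_gt1 g.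
have [|v gv] := gl (pfx l p); first by rewrite size_pfx.
have pE : p = prepend v (shift l p) by rewrite -gv pfxK gp.
exists l, (size v) => x xp i; rewrite -(pfxK l x) xp gv.
case: ltnP => iv; first by rewrite pE !prepend_lt //; exact: set_nth_default.
by rewrite !prepend_ge ?size_pfx ?leq_addl // addnK.
Qed.

(** By [germ_shift] a germ at p is determined by an integer shift, and shifts add
    up when germs are composed. *)
Lemma locally_fixed_commutator g h p : g p = p -> h p = p -> locally_fixed [~ g, h] p.
Proof.
move=> gp hp; have [l [s gE]] := germ_shift gp; have [l' [s' hE]] := germ_shift hp.
have pg i : (s <= i)%N -> p (i - s + l)%N = p i.
  by move=> si; have := gE p erefl i; rewrite gp ltnNge si.
have ph i : (s' <= i)%N -> p (i - s' + l')%N = p i.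
  by move=> si; have := hE p erefl i; rewrite hp ltnNge si.
exists (l + l')%N => x /pfx_eqP xp.
have xl : pfx l x = pfx l p by apply/pfx_eqP => i il; apply: xp; lia.
have xl' : pfx l' x = pfx l' p by apply/pfx_eqP => i il; apply: xp; lia.
have hxl : pfx l (h x) = pfx l p.
  apply/pfx_eqP => i il; rewrite hE //; case: ltnP => // si.
  by rewrite xp ?ph //; lia.
have gxl : pfx l' (g x) = pfx l' p.
  apply/pfx_eqP => i il; rewrite gE //; case: ltnP => // si.
  by rewrite xp ?pg //; lia.
suff ghx : g (h x) = h (g x).
  by rewrite commgEl conjgE !ht_mulE ghx !ht_invK.
apply/funext => i; rewrite gE // hE // [RHS]hE // gE //.
case: (ltnP i s) => is_; case: (ltnP i s') => is' //.
- case: ltnP => // j; first by rewrite ph.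
  by rewrite xp ?pg ?ph //; lia.
- case: ltnP => // j; first by rewrite pg.
  by rewrite xp ?ph ?pg //; lia.
case: ltnP => j; case: ltnP => j' //.
- by rewrite pg // ph.
- by rewrite pg // xp ?pg ?ph //; lia.
- by rewrite ph // xp ?ph ?pg //; lia.
by congr x; lia.
Qed.

Lemma prepend_fixpoint_unique u v x y : u != v ->
  prepend u x = prepend v x -> prepend u y = prepend v y -> x = y.
Proof.
wlog uv : u v / (size u <= size v)%N => [th ne xE yE|].
  have [l|/ltnW l] := leqP (size u) (size v); first exact: th ne xE yE.
  by apply: (th v u); rewrite 1?eq_sym.
move=> ne xE yE; have vE := prepend_prefix uv xE.
move: ne xE yE; rewrite {}vE; move: (drop _ _) => {uv}z ne.
rewrite !prepend_cat => /prepend_inj xE /prepend_inj yE.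
have z0 : (0 < size z)%N by move: ne; rewrite lt0n size_eq0; apply: contraNneq => ->;
  rewrite cats0.
apply/funext; elim/ltn_ind => i IH; rewrite xE yE.
have [iz|zi] := ltnP i (size z); first by rewrite !prepend_lt //;
  exact: set_nth_default.
by rewrite !prepend_ge // IH //; lia.
Qed.

Lemma pigeonhole (T : finType) (f : nat -> T) :
  exists i j, [/\ (i < j)%N, (j <= #|T|)%N & f i = f j].
Proof.
apply: contrapT => no; have : injective (fun i : 'I_#|T|.+1 => f i).
  move=> i j fij; apply: val_inj; case: (ltngtP i j) => // ij; case: no.
    by exists (val i), (val j); split; rewrite // -ltnS ltn_ord.
  by exists (val j), (val i); split; rewrite // -ltnS ltn_ord.
by move/leq_card; rewrite card_ord ltnn.
Qed.

Lemma frontier_commute g h p : h * g = g * h -> frontier g p -> frontier g (h p).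
Proof.
move=> hg [gp np]; have hgx x : h (g x) = g (h x) by rewrite -!ht_mulE hg.
split; first by rewrite -hgx gp.
case=> k gk; apply: np; have [l hl] := ht_near n_gt1 h p k.
exists l => x /esym/hl /esym/gk; rewrite -hgx.
exact: (can_inj (ht_invK h)).
Qed.

Lemma expg_fix g r s p : (r %| s)%N -> (g ^+ r) p = p -> (g ^+ s) p = p.
Proof.
move=> /dvdnP[t ->] gp; rewrite mulnC expgnA.
by elim: t => [|t IH]; rewrite ?expgS ?ht_mulE ?IH.
Qed.

(** The frontier is finite: it meets a cone that g maps to a different cone in at
    most one point, by [prepend_fixpoint_unique]. A commuting element permutes it. *)
Lemma frontier_fixed_power g : exists2 r, (0 < r)%N &
  forall h, h * g = g * h -> forall p, frontier g p -> (h ^+ r) p = p.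
Proof.
have [l gl] := maps_dom n_gt1 g.
exists (#|{: l.-tuple 'I_n}|)`!; first exact: fact_gt0.
move=> h hg p gp.
have fr i : frontier g ((h ^+ i) p).
  by elim: i => // i IH; rewrite expgS ht_mulE; exact: frontier_commute.
have [i [j [ij jT]]] := pigeonhole (fun i => [tuple of mkseq ((h ^+ i) p) l]).
move=> /(congr1 val) /= e; apply: (@expg_fix _ (j - i)).
  by apply: dvdn_fact; rewrite subn_gt0 ij /= (leq_trans (leq_subr _ _)).
have [|v gv] := gl (pfx l ((h ^+ i) p)); first by rewrite size_pfx.
have [gi ni] := fr i; have [gj _] := fr j.
have ne : pfx l ((h ^+ i) p) != v.
  apply/eqP => vE; apply: ni; exists l => x xp.
  by rewrite -(pfxK l x) xp gv vE.
have jE : prepend (pfx l ((h ^+ i) p)) (shift l ((h ^+ j) p)) = (h ^+ j) p.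
  by rewrite [pfx l _]e pfxK.
have pE : (h ^+ i) p = (h ^+ j) p.
  rewrite -(pfxK l ((h ^+ i) p)) -[RHS]jE.
  congr prepend; apply: (prepend_fixpoint_unique ne).
    by rewrite -gv pfxK gi.
  by rewrite -gv jE gj.
apply: (can_inj (ht_invK (h ^+ i))); rewrite -ht_mulE -expgnDr subnKC //.
exact: ltnW.
Qed.

End Dynamics.

(** * Orbits of cones *)

Section Orbits.
Local Open Scope group_scope.
Variable n : nat.
Hypothesis n_gt1 : (1 < n)%N.
Implicit Types (a b : 'I_n) (c d e q u v w z : seq 'I_n) (x y p : cantor n).
Implicit Types (g h : higman_thompson n).

Definition repeat (r : nat) z : seq 'I_n := iter r (cat z) [::].

Lemma repeatS r z : repeat r.+1 z = z ++ repeat r z.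
Proof. by []. Qed.

Lemma repeatSr r z : repeat r.+1 z = repeat r z ++ z.
Proof. by elim: r => [|r IH]; rewrite repeatS ?cats0 // {1}IH catA. Qed.

Lemma size_repeat r z : size (repeat r z) = (r * size z)%N.
Proof. by elim: r => // r IH; rewrite repeatS size_cat IH mulSn. Qed.

Lemma maps_repeat g c z r : maps g c (c ++ z) -> maps (g ^+ r) c (c ++ repeat r z).
Proof.
move=> gc; elim: r => [|r IH]; first by rewrite cats0.
by rewrite expgS repeatS catA; apply: mapsM IH; exact: maps_cat.
Qed.

Lemma maps_unrepeat g c z r : maps g (c ++ z) c -> maps (g ^+ r) (c ++ repeat r z) c.
Proof.
move=> gc; elim: r => [|r IH]; first by rewrite cats0.
by rewrite expgS repeatSr catA; apply: mapsM gc _; exact: maps_cat.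
Qed.

Lemma maps_rest g h u v w : maps h u v -> maps (g * h) u w -> maps g v w.
Proof. by move=> hu gu x; rewrite -hu -ht_mulE gu. Qed.

Definition dom g v := exists w, maps g v w.

Definition live g v := forall j, dom (g ^+ j) v.

Lemma live_maps g v w j : live g v -> maps (g ^+ j) v w -> live g w.
Proof.
move=> vg vw i; have [w' vw'] := vg (i + j)%N; exists w'.
by apply: maps_rest vw _; rewrite -expgnDr.
Qed.

Lemma not_live_escape g v : ~ live g v -> exists j w,
  [/\ maps (g ^+ j) v w, forall i, (i <= j)%N -> dom (g ^+ i) v & ~ dom g w].
Proof.
move=> /existsNP[j0 nj0].
have exP : exists j, `[< ~ dom (g ^+ j) v >] by exists j0; apply/asboolP.
case: (ex_minnP exP) => -[|j] /asboolP nj jmin; first by case: nj; exists v.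
have domi i : (i <= j)%N -> dom (g ^+ i) v.
  move=> ij; apply: contrapT => /asboolP /jmin; by rewrite ltnNge ij.
have [w vw] := domi j (leqnn _); exists j, w; split=> // -[w' ww'].
by apply: nj; exists w'; rewrite expgS; exact: mapsM ww' vw.
Qed.

Section Orbit.
Variables (g : higman_thompson n) (N : nat).
Hypothesis domN : forall u, (N <= size u)%N -> dom g u.

(** Take the shortest prefix of u that is live: its parent is not, so it is brought
    to a word that g cannot read; that word has length less than N, and its child
    gets length at most N. *)
Lemma live_hits_short u : live g u ->
  exists j c q, [/\ (size c <= N)%N, live g c & maps (g ^+ j) u (c ++ q)].
Proof.
move=> ug; have exP : exists k, `[< live g (take k u) >].
  by exists (size u); apply/asboolP; rewrite take_size.
case: (ex_minnP exP) => -[|k] /asboolP lk kmin.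
  by exists 0%N, [::], u; rewrite take0 in lk.
have ku : (k < size u)%N by apply: kmin; apply/asboolP; rewrite take_size.
have [|j [w [kw _ nw]]] := @not_live_escape g (take k u).
  by move=> /asboolP /kmin; rewrite ltnn.
have wN : (size w < N)%N by rewrite ltnNge; apply/negP => /domN.
have a : 'I_n := letter0 n_gt1.
have tk : take k.+1 u = take k u ++ [:: nth a u k] by rewrite (take_nth a) // cats1.
have jc : maps (g ^+ j) (take k.+1 u) (w ++ [:: nth a u k]) by rewrite tk;
  exact: maps_cat.
exists j, (w ++ [:: nth a u k]), (drop k.+1 u); split.
- by rewrite size_cat addn1.
- exact: live_maps jc.
- by rewrite -{1}(cat_take_drop k.+1 u); exact: maps_cat.
Qed.

(** The orbit of a live word returns to short live words forever, and there are
    finitely many short words. *)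
Lemma live_recurrent c : (size c <= N)%N -> live g c ->
  exists j d q t z, [/\ maps (g ^+ j) c (d ++ q), (size d <= N)%N, (0 < t)%N &
    maps (g ^+ t) d (d ++ z)].
Proof.
move=> cN lc.
have /choice[s sP] : forall c, exists d, (size c <= N)%N /\ live g c ->
    (size d <= N)%N /\ live g d /\ exists t q, (0 < t)%N /\ maps (g ^+ t) c (d ++ q).
  move=> e; have [[eN le]|] := pselect ((size e <= N)%N /\ live g e);
    last by exists e.
  have [u eu] := le 1%N; have [j [d [q [dN ld ud]]]] := live_hits_short (live_maps le
    eu).
  exists d => _; split=> //; split=> //; exists (j + 1)%N, q; split;
    first by rewrite addn1.
  by rewrite expgnDr; exact: mapsM ud eu.
pose e i := iter i s c.
have eP i : (size (e i) <= N)%N /\ live g (e i).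
  by elim: i => // i IH; have [? []] := sP _ IH.
have trav i j : (i < j)%N -> exists t q, (0 < t)%N /\ maps (g ^+ t) (e i) (e j ++ q).
  elim: j => // j IH; rewrite ltnS leq_eqVlt => /predU1P[->|/IH [t [q [t0 ij]]]].
    by have [_ [_ H]] := sP _ (eP j).
  have [_ [_ [t' [q' [_ jj']]]]] := sP _ (eP j).
  exists (t' + t)%N, (q' ++ q); split; first by rewrite addn_gt0 t0 orbT.
  by rewrite expgnDr catA; apply: mapsM ij; exact: maps_cat.
have [i [j [ij _ eij]]] := pigeonhole (fun i => (Bseq (eP i).1 : N.-bseq 'I_n)).
have {}eij : e i = e j by have := congr1 val eij.
have [t [z [t0 tz]]] := trav i j ij; rewrite -eij in tz.
have [j' [q j'q]] : exists j' q, maps (g ^+ j') c (e i ++ q).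
  have [i0|i0] := posnP i; first by exists 0%N, [::]; rewrite i0 cats0.
  by have [j' [q [_ ?]]] := trav 0%N i i0; exists j', q.
by exists j', (e i), q, t, z; split=> //; case: (eP i).
Qed.

(** If y has a live prefix, the forward orbit of y is caught in a cone mapped into
    itself. Otherwise each prefix of y gets stuck at a short word; two prefixes
    stuck at the same word w show that the inverse of g maps w into itself. *)
Lemma orbit_meets_periodic_cone y : exists j c t z,
  [/\ (size c <= N)%N, (0 < t)%N, begins c ((g ^+ j) y) &
    maps (g ^+ t) c (c ++ z) \/ maps (g ^+ t) (c ++ z) c].
Proof.
have maps_in h u v x : maps h u v -> begins u x -> begins v (h x).
  by move=> huv; rewrite (maps_begins _ huv).
have [[k lk]|nlive] := pselect (exists k, live g (pfx k y)).
  have [j [c [q [cN lc jc]]]] := live_hits_short lk.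
  have [j' [d [q' [t [z [cd dN t0 dz]]]]]] := live_recurrent cN lc.
  exists (j' + j)%N, d, t, z; split=> //; last by left.
  rewrite expgnDr ht_mulE; have yc := begins_catl (maps_in _ _ _ _ jc (begins_pfx k
    y)).
  exact: begins_catl (maps_in _ _ _ _ cd yc).
have /choice[jw jwP] : forall k, exists jw : nat * seq 'I_n,
    [/\ maps (g ^+ jw.1) (pfx k y) jw.2,
      forall i, (i <= jw.1)%N -> dom (g ^+ i) (pfx k y) & ~ dom g jw.2].
  move=> k; have [|j [w wP]] := @not_live_escape g (pfx k y).
    by move=> lk; apply: nlive; exists k.
  by exists (j, w).
have wN k : (size (jw k).2 <= N)%N.
  by have [_ _ nw] := jwP k; rewrite leqNgt; apply/negP => /ltnW/domN.
have [k [l [kl _ /(congr1 val) /= ekl]]] := pigeonhole (fun k => (Bseq (wN k) :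
  N.-bseq 'I_n)).
have [kw domk nw] := jwP k; have [lw doml _] := jwP l.
pose z := pfx (l - k) (shift k y).
have lE : pfx l y = pfx k y ++ z by rewrite -pfxD subnKC // ltnW.
have z0 : (0 < size z)%N by rewrite size_pfx subn_gt0.
set i := (jw k).1 in kw domk; set j := (jw l).1 in lw doml.
set w := (jw k).2 in kw nw ekl; rewrite -ekl lE in lw.
have wy := maps_in _ _ _ _ kw (begins_pfx k y).
case: (ltnP i j) => ij.
  exists i, w, (j - i)%N, z; split=> //; [exact: wN|by rewrite subn_gt0|right].
  apply: maps_rest (maps_cat z kw) _; rewrite -expgnDr subnK //; exact: ltnW.
have [w' kw'] := domk j ij.
have wE : w' ++ z = w by exact: (maps_fun n_gt1 (maps_cat z kw') lw).
case: nw; have [ji|ji] := posnP (i - j)%N.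
  have iEj : i = j by apply/eqP; rewrite eqn_leq ij -subn_eq0 ji.
  rewrite iEj in kw; move: z0; have := maps_fun n_gt1 kw kw'; rewrite -wE.
  by move=> /(congr1 size)/eqP; rewrite size_cat -{2}[size w']addn0 eqn_add2l => /eqP
    ->.
have [w'' w'w''] : dom g w'.
  have [|w'' kw''] := domk j.+1; first by rewrite -subn_gt0.
  by exists w''; apply: maps_rest kw' _; rewrite -expgS.
by exists (w'' ++ z); rewrite -wE; exact: maps_cat.
Qed.

End Orbit.

(** Only finitely many short words are involved, so one power serves them all. *)
Lemma orbit_meets_fixed_cone g : exists2 k, (0 < k)%N & forall y, exists j c z,
  begins c ((g ^+ j) y) /\ (maps (g ^+ k) c (c ++ z) \/ maps (g ^+ k) (c ++ z) c).
Proof.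
have [N domN] := maps_dom n_gt1 g.
pose good c (t : nat) := exists z, maps (g ^+ t) c (c ++ z) \/ maps (g ^+ t) (c ++ z)
  c.
have /choice[t tP] : forall c, exists t, (0 < t)%N /\
    ((exists t', (0 < t')%N /\ good c t') -> good c t).
  move=> c; have [[t' [t0 gt']]|no] := pselect (exists t', (0 < t')%N /\ good c t').
    by exists t'.
  by exists 1%N.
exists (\prod_(c : N.-bseq 'I_n) t c)%N; first by rewrite prodn_gt0 // => c;
  case: (tP c).
move=> y; have [j [c [t' [z [cN t'0 yc cz]]]]] := orbit_meets_periodic_cone domN y.
have [z' z'P] : good c (t c) by apply: (tP c).2; exists t'; split=> //; exists z.
have /dvdnP[r ->] : (t c %| \prod_(c : N.-bseq 'I_n) t c)%N.
  by rewrite (bigD1 (Bseq cN)) //= dvdn_mulr.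
rewrite mulnC expgnA; exists j, c, (repeat r z'); split=> //.
by case: z'P => z'P; [left; exact: maps_repeat|right; exact: maps_unrepeat].
Qed.

(** A point y moved by g^k has an iterate in a cone that g^k, or its inverse, maps
    strictly into itself. The fixed point p of that contraction lies on the
    frontier. Some iterate of y is so close to p that h fixes it, and h commutes
    with g. *)
Lemma commuting_fixes_moved g : exists2 k, (0 < k)%N & forall h, h * g = g * h ->
  (forall p, frontier (g ^+ k) p -> locally_fixed h p) ->
  forall y, (g ^+ k) y <> y -> h y = y.
Proof.
have [k k0 kP] := orbit_meets_fixed_cone g; exists k => // h hg hP y gy.
have [j [c [z [yc cz]]]] := kP y.
have hgX i : h * g ^+ i = g ^+ i * h by exact/commuteX.
set f := g ^+ k in hP gy cz.
have fI := can_inj (ht_invK (g ^+ j)).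
have fy' : f ((g ^+ j) y) <> (g ^+ j) y.
  by rewrite -ht_mulE -expgnDr addnC expgnDr ht_mulE => /fI.
apply/fI; rewrite -ht_mulE -hgX ht_mulE; move: {gy} ((g ^+ j) y) yc fy' => {}y yc fy.
have hf i x : h ((f ^+ i) x) = (f ^+ i) (h x) by rewrite -!ht_mulE -expgnA hgX.
have [x0 yE] := beginsP _ _ yc.
have z0 : z != [::].
  apply/eqP => z0; apply: fy; rewrite z0 cats0 in cz.
  by rewrite yE; case: cz => ->.
have sz0 : (0 < size z)%N by rewrite lt0n size_eq0.
(* zz is the infinite repetition of z, and p its translate into the cone of c. *)
pose zz : cantor n := fun i => nth (letter0 n_gt1) z (i %% size z)%N.
have zzE : prepend z zz = zz.
  apply/funext => i; have [iz|zi] := ltnP i (size z).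
    by rewrite prepend_lt // /zz (modn_small iz); exact: set_nth_default.
  by rewrite prepend_ge // /zz -{2}(subnK zi) modnDr.
have zzr r : prepend (repeat r z) zz = zz.
  by elim: r => [|r IH]; rewrite ?prepend_nil // repeatS prepend_cat IH.
pose p := prepend c zz.
have near r x : pfx r (prepend (c ++ repeat r z) x) = pfx r p.
  have rs : (r <= size (c ++ repeat r z))%N.
    by rewrite size_cat size_repeat (leq_trans (leq_pmulr r sz0)) // leq_addl.
  apply: pfx_le rs _; rewrite pfx_prepend /p -(zzr r) -prepend_cat.
  by rewrite pfx_prepend.
have fp : f p = p.
  by case: cz => cz; [rewrite cz prepend_cat zzE|rewrite /p -{1}zzE -prepend_cat cz].
have [r hr] : locally_fixed h p.
  apply: hP; split=> // -[r fr]; have [x zx] := prepend_nontrivial n_gt1 z0.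
  apply: zx; apply: (@prepend_inj _ (c ++ repeat r z)).
  case: cz => cz.
    rewrite -prepend_cat -catA -repeatSr repeatS catA [LHS]prepend_cat -cz
      -prepend_cat.
    exact/fr/near.
  rewrite -[LHS](fr _ (near r _)) -prepend_cat -catA -repeatSr repeatS catA.
  by rewrite prepend_cat cz -prepend_cat.
have hfix x : h (prepend (c ++ repeat r z) x) = prepend (c ++ repeat r z) x by
  exact/hr/near.
case: cz => cz.
  have fr := maps_repeat r cz; apply: (can_inj (ht_invK (f ^+ r))).
  by rewrite -hf yE fr.
have fr := maps_unrepeat r cz.
by rewrite yE -fr hf hfix.
Qed.

End Orbits.

(** * Points moved by the alternating subgroups *)

Section Moved.
Local Open Scope group_scope.
Variables m n : nat.
Hypotheses (m_gt1 : (1 < m)%N) (n_gt1 : (1 < n)%N).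
Variable rho : UMagmaMorphism.type (higman_thompson m) (higman_thompson n).
Implicit Types (u v w c d z : seq 'I_m) (x y p : cantor n).
Implicit Types (g h s t : higman_thompson m) (E F : set (seq 'I_m)).

Let rhoM g h x : rho (g * h) x = rho g (rho h x).
Proof. by rewrite gmulfM. Qed.

Let rho1 x : rho 1 x = x.
Proof. by rewrite gmulf1. Qed.

Let rhoK g x : rho g^-1 (rho g x) = x.
Proof. by rewrite gmulfV ht_invK. Qed.

Let rhoVK g x : rho g (rho g^-1 x) = x.
Proof. by rewrite gmulfV ht_invVK. Qed.

Let rhoI g : injective (rho g).
Proof. exact: can_inj (ht_invK (rho g)). Qed.

(** Only generators are considered, but a point fixed by them is fixed by the whole
    group, see [not_movedP]. *)
Definition moved E x := exists2 h, three_cycle_in E h & rho h x <> x.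

Definition stabiliser x : set (higman_thompson m) := [set h | rho h x = x].

Lemma stabiliser_subgroup x : is_subgroup (stabiliser x).
Proof.
split=> [|g h gx hx]; first exact: rho1.
by rewrite /stabiliser /= rhoM -{1}hx rhoK.
Qed.

Lemma not_movedP E x : ~ moved E x <-> alternating E `<=` stabiliser x.
Proof.
split=> [nE|Ex [h hE]]; last by apply; apply: (Ex h); exact: three_cycle_alternating.
apply: alternating_min; first exact: stabiliser_subgroup.
by move=> h hE; apply: contrapT => hx; apply: nE; exists h.
Qed.

Lemma movedS E F x : E `<=` F -> moved E x -> moved F x.
Proof. by move=> EF [h hE hx]; exists h => //; exact: three_cycle_inS hE. Qed.

(** Germs at a common fixed point commute, and a perfect group has no
    nontrivial commutative quotient. *)
Lemma alternating_locally_fixed E x t : extension_closed E ->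
  alternating E `<=` stabiliser x -> alternating E t -> locally_fixed (rho t) x.
Proof.
move=> Ecl Ex; move: t.
apply: (alternating_perfect m_gt1 (M := [set t | locally_fixed (rho t) x]) Ecl).
  split=> [|s t sx tx]; first by exists 0%N => ? _; exact: rho1.
  rewrite /= gmulfM gmulfV; apply: locally_fixedM => //; exact: locally_fixedV.
move=> s t /three_cycle_alternating sE /three_cycle_alternating tE /=.
rewrite gmulfR; exact (locally_fixed_commutator n_gt1 (Ex s sE) (Ex t tE)).
Qed.

(** Let g be the element of [alternating E] given by [normal_closure] and delta the
    power of rho g given by [commuting_fixes_moved]. The group [alternating F]
    commutes with delta, so it acts on its finite frontier, and trivially by the
    choice of q; hence it also acts trivially near the frontier, and fixes whatever
    delta moves. The elements of [alternating E] that fix all the points moved by F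
    thus include a power of g, so they are the whole group. *)
Lemma moved_disjoint E F x : extension_closed E -> extension_closed F ->
  (forall u v, E u -> F v -> incomparable u v) -> moved E x -> ~ moved F x.
Proof.
move=> Ecl Fcl EF [hE hEE hEx] Fx; apply: hEx.
have [e Ee] : exists e, E e by case: (hEE) => u [? [? [_ [? _ _]]]]; exists u.
have [f Ff] : exists f, F f.
  by case: Fx => h [u [? [? [_ [? _ _]]]]] _; exists u.
have [g gE gP] := normal_closure m_gt1 Ecl Ee.
have [q qF qP] := normal_closure m_gt1 Fcl Ff.
have comm s t : alternating E s -> alternating F t -> rho t * rho s = rho s * rho t.
  move=> /alternating_supported sE /alternating_supported tF.
  by rewrite -!gmulfM (supported_commute sE tF).
have [k k0 kP] := commuting_fixes_moved n_gt1 (rho g).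
set delta := rho g ^+ k in kP.
have commd t : alternating F t -> rho t * delta = delta * rho t.
  by move=> tF; apply: commuteX; exact: comm.
have [r r0 rP] := frontier_fixed_power n_gt1 delta.
have alt_exp G s i : alternating G s -> alternating G (s ^+ i).
  move=> sG; elim: i => [|i IH]; first exact: subgroup1 (alternating_subgroup G).
  by rewrite expgS; apply: (subgroupM (alternating_subgroup G)).
have frontier_fixed t p : alternating F t -> frontier delta p -> rho t p = p.
  pose N0 := alternating F `&` [set t | forall p, frontier delta p -> rho t p = p].
  move=> tF; suff : N0 t by case=> _; apply.
  apply: (qP N0 r) tF => //.
  - split=> [|s {}t [sF sP] [{}tF tP]]; split.
    + exact: subgroup1 (alternating_subgroup F).
    + by move=> p' _; exact: rho1.
    + by apply: (subgroupM (alternating_subgroup F)) => //;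
        exact: (subgroupV (alternating_subgroup F)).
    + by move=> p' p'P; rewrite rhoM -{1}(tP _ p'P) rhoK sP.
  - move=> s {}t /three_cycle_alternating sF [{}tF tP].
    have sVF : alternating F s^-1 by exact: (subgroupV (alternating_subgroup F)).
    split; first by do 2?apply: (subgroupM (alternating_subgroup F)).
    move=> p' p'P; rewrite !rhoM tP ?rhoVK //.
    exact: (frontier_commute n_gt1 (commd _ sVF)).
  - split; first exact: alt_exp.
    by move=> p' p'P; rewrite gmulfXn; apply: rP => //; exact: commd.
have fixF t y : alternating F t -> delta y <> y -> rho t y = y.
  move=> tF; apply: kP; first exact: comm.
  move=> p pP; apply: (alternating_locally_fixed Fcl) tF => s sF.
  exact: frontier_fixed.
pose N1 := alternating E `&` [set h | forall y, moved F y -> rho h y = y].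
suff : N1 hE by case=> _; apply.
apply: (gP N1 k) (three_cycle_alternating hEE) => //.
- split=> [|s t [sE sP] [tE tP]]; split.
  + exact: subgroup1 (alternating_subgroup E).
  + by move=> y _; exact: rho1.
  + by apply: (subgroupM (alternating_subgroup E)) => //;
      exact: (subgroupV (alternating_subgroup E)).
  + by move=> y yF; rewrite rhoM -{1}(tP _ yF) rhoK sP.
- move=> s t /three_cycle_alternating sE [tE tP].
  have sVE : alternating E s^-1 by exact: (subgroupV (alternating_subgroup E)).
  split; first by do 2?apply: (subgroupM (alternating_subgroup E)).
  move=> y [h hF hy]; rewrite !rhoM tP ?rhoVK //; exists h => //.
  have := comm _ _ sVE (three_cycle_alternating hF) => sh.
  by rewrite -ht_mulE sh ht_mulE => /rhoI.
- split; first exact: alt_exp.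
  move=> y [h hF hy]; rewrite gmulfXn; apply: contrapT => gy; apply: hy.
  by apply: fixF => //; exact: three_cycle_alternating.
Qed.

Lemma moved_long E x l : extension_closed E -> moved E x ->
  moved [set u | E u /\ (l <= size u)%N] x.
Proof.
move=> Ecl; apply: contraPP => /not_movedP nE; apply/not_movedP.
apply: (alternating_refine (l := l) Ecl (stabiliser_subgroup x)).
move=> h u v w hP [Eu Ev Ew] [lu lv lw]; apply: (nE h).
apply: three_cycle_alternating; by exists u, v, w.
Qed.

Lemma moved_overlap E F e x : extension_closed E -> extension_closed F ->
  E e -> F e -> moved (E `|` F) x -> moved E x \/ moved F x.
Proof.
move=> Ecl Fcl Ee Fe; apply: contraPP => /not_orP[/not_movedP nE /not_movedP nF].
apply/not_movedP/(alternating_overlap m_gt1 Ecl Fcl Ee Fe) => //.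
exact: stabiliser_subgroup.
Qed.

Lemma extension_closedU E F : extension_closed E -> extension_closed F ->
  extension_closed (E `|` F).
Proof. by move=> Ecl Fcl u z [/Ecl ?|/Fcl ?]; [left|right]. Qed.

(** Suppose that x is moved by the union only. Then it is moved by the union of any
    two cones c of F and d of E: if not, overlaps transfer the motion to (E minus d)
    with c and to (F minus c) with d, which are disjoint. Now two disjoint choices of
    c and d contradict [moved_disjoint]. *)
Lemma moved_union E F x : extension_closed E -> extension_closed F ->
  (forall u v, E u -> F v -> incomparable u v) ->
  moved (E `|` F) x -> moved E x \/ moved F x.
Proof.
move=> Ecl Fcl EF EFx; apply: contrapT => /not_orP[nE nF].
have C c d : incomparable c d -> incomparable d c by rewrite incomparableC.
have step G H c d : extension_closed G -> extension_closed H -> G d -> H c ->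
    ~ moved H x -> ~ moved (cone c `|` cone d) x -> moved (G `|` H) x ->
    moved ([set u | G u /\ incomparable u d] `|` cone c) x.
  move=> Gcl Hcl Gd Hc nH ncd GHx.
  have Gcx : moved (G `|` cone c) x.
    have [|||||//|//] := @moved_overlap (G `|` cone c) H c x.
    - exact: extension_closedU Gcl (@cone_closed _ _).
    - exact: Hcl.
    - by right; rewrite /cone /= prefix_refl.
    - exact: Hc.
    - by apply: movedS GHx => u [|]; [left; left|right].
  have [|||||//|//] := @moved_overlap ([set u | G u /\ incomparable u d] `|` cone c)
    (cone c `|` cone d) c x.
  - apply: extension_closedU (@cone_closed _ _) => u z [Gu ud].
    by split; [exact: Gcl|exact: incomparable_catl].
  - by apply: extension_closedU; exact: cone_closed.
  - by right; rewrite /cone /= prefix_refl.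
  - by left; rewrite /cone /= prefix_refl.
  have := moved_long (size d) (extension_closedU Gcl (@cone_closed _ c)) Gcx.
  apply: movedS => u [[Gu|cu] du]; last by right; left.
  have [ud|ud] := boolP (prefix d u); first by right; right.
  left; left; split=> //; rewrite /incomparable ud andbT.
  apply: contra ud => ud; move: (ud); rewrite prefixE => /eqP <-.
  have := size_prefix ud => us.
  by rewrite (take_oversize (n := size u)) ?prefix_refl //.
have both c d : F c -> E d -> moved (cone c `|` cone d) x.
  move=> Fc Ed; apply: contrapT => ncd.
  have H1 := step E F c d Ecl Fcl Ed Fc nF ncd EFx.
  have H2 := step F E d c Fcl Ecl Fc Ed nE.
  rewrite setUC in ncd; rewrite setUC in EFx; have {}H2 := H2 ncd EFx.
  apply: moved_disjoint H1 H2.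
  - apply: extension_closedU (@cone_closed _ _) => u z [Gu ud].
    by split; [exact: Ecl|exact: incomparable_catl].
  - apply: extension_closedU (@cone_closed _ _) => u z [Gu ud].
    by split; [exact: Fcl|exact: incomparable_catl].
  move=> u v [[Eu ud]|/prefixP[z ->]] [[Fv vc]|/prefixP[z' ->]].
  - exact: EF.
  - exact: incomparable_catr.
  - exact/C/incomparable_catr.
  - by apply: incomparable_cat; apply: C; exact: EF.
have [d Ed] : exists d, E d.
  apply: contrapT => nd; apply: nF; apply: movedS EFx => u [Eu|//].
  by case: nd; exists u.
have [c Fc] : exists c, F c.
  apply: contrapT => nc; apply: nE; apply: movedS EFx => u [//|Fu].
  by case: nc; exists u.
pose o := letter0 m_gt1; pose i1 := letter1 m_gt1.
have H1 := both _ _ (Fcl _ [:: o] Fc) (Ecl _ [:: o] Ed).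
have H2 := both _ _ (Fcl _ [:: i1] Fc) (Ecl _ [:: i1] Ed).
have cd : incomparable c d by exact/C/EF.
have oi e : incomparable (e ++ [:: o]) (e ++ [:: i1]).
  by rewrite incomparable_cat2l; exact: incomparable_size.
apply: moved_disjoint H1 H2; try by apply: extension_closedU; exact: cone_closed.
move=> u v [] /prefixP[z ->] [] /prefixP[z' ->]; apply: incomparable_cat => //.
  by apply: incomparable_cat.
by apply: incomparable_cat; exact: C.
Qed.

Lemma moved_child c x : moved (cone c) x ->
  exists a : 'I_m, moved (cone (c ++ [:: a])) x.
Proof.
move=> cx; have : moved [set u | exists2 a, a \in enum 'I_m & prefix (c ++ [:: a]) u]
  x.
  apply: movedS (moved_long (size c).+1 (@cone_closed _ _) cx).
  move=> _ [/prefixP[[|a z] ->] /=]; first by rewrite cats0 ltnn.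
  by move=> _; exists a; rewrite ?mem_enum // -(cat1s a z) catA prefix_prefix.
elim: (enum _) (enum_uniq 'I_m) => [_ [h [u [? [? [_ [[? //]]]]]]]|a s IH /=
  /andP[as_ us] H].
have [||||ax|/(IH us)//] := @moved_union (cone (c ++ [:: a]))
  [set u | exists2 b, b \in s & prefix (c ++ [:: b]) u] x; last by exists a.
- exact: cone_closed.
- by move=> u z [b bs bu]; exists b => //; exact: prefix_catl.
- move=> _ _ /prefixP[z ->] [b bs /prefixP[z' ->]]; apply: incomparable_cat.
  rewrite incomparable_cat2l; apply: incomparable_size => //.
  by rewrite eqseq_cons andbT; apply: contraNneq as_ => ->.
apply: movedS H => u [b]; rewrite inE => /predU1P[->|bs] bu; [by left|].
by right; exists b.
Qed.

Lemma moved_maps g c d x : maps g c d -> moved (cone c) x -> moved (cone d) (rho g x).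
Proof.
move=> gcd [h [u [v [w [hP [cu cv cw]]]]] hx]; exists (g * h * g^-1).
  have img e : prefix c e -> exists2 e', prefix d e' & maps g e e'.
    by move=> /prefixP[z ->]; exists (d ++ z); [exact: prefix_prefix|exact: maps_cat].
  have [u' du gu] := img u cu; have [v' dv gv] := img v cv;
    have [w' dw gw] := img w cw.
  by exists u', v', w'; split=> //; exact (three_cycle_conj m_gt1 gu gv gw hP).
by rewrite !rhoM rhoK => /rhoI.
Qed.

Lemma moved_near E x : moved E x ->
  exists k, forall y, pfx k x = pfx k y -> moved E y.
Proof.
move=> [h hE hx]; have [i hi] : exists i, rho h x i <> x i.
  by apply: contrapT => no; apply: hx; apply/funext => i; apply: contrapT => hi;
    apply: no; exists i.
have [l lP] := ht_near n_gt1 (rho h) x i.+1.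
exists (maxn l i.+1) => y xy; exists h => // hy; apply: hi.
have /lP/pfx_eqP/(_ i (leqnn _)) -> : pfx l x = pfx l y by apply: pfx_le xy;
  exact: leq_maxl.
rewrite hy; have /pfx_eqP/(_ i (leqnn _)) -> // : pfx i.+1 x = pfx i.+1 y.
by apply: pfx_le xy; exact: leq_maxr.
Qed.

(** Finitely many three-cycles displace all the cones of depth 2, and they fix all
    the points y near x. If such a y were moved, it would be moved by some cone of
    depth 2, and also by the disjoint image of that cone. *)
Lemma unmoved_near x : ~ moved setT x ->
  exists k, forall y, pfx k y = pfx k x -> ~ moved setT y.
Proof.
move=> /not_movedP nx.
have Tcl : @extension_closed m setT by [].
have loc t : alternating setT t -> locally_fixed (rho t) x.
  exact: alternating_locally_fixed.
have /choice[k kP] : forall ab : 'I_m * 'I_m, exists k, exists t d,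
    [/\ maps t [:: ab.1; ab.2] d, incomparable [:: ab.1; ab.2] d &
      forall y, pfx k y = pfx k x -> rho t y = y].
  move=> [a b] /=; have ne (e : 'I_m) : e != other m_gt1 e by rewrite eq_sym
    other_neq.
  have [t tP] : exists t, three_cycle t [:: a; b] [:: a;
    other m_gt1 b] [:: other m_gt1 a; b].
    apply: three_cycle_exists; apply: incomparable_size => //; rewrite !eqseq_cons.
    - by rewrite negb_and negb_and ne orbT.
    - by rewrite negb_and ne.
    - by rewrite negb_and eq_sym ne.
  have [|k tk] := loc t; first by apply: three_cycle_alternating; do 3!eexists;
    exact: conj tP _.
  by exists k, t, [:: a; other m_gt1 b]; case: tP => -[? _ _] [? _ _ _].
exists (\max_(ab : 'I_m * 'I_m) k ab)%N => y yx ym.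
have [a ya] : exists a : 'I_m, moved (cone [:: a]) y.
  by have [|a] := @moved_child [::] y; [by apply: movedS ym => u _;
    exact: prefix0s|exists a].
have [b yab] := moved_child ya; have [t [d [td abd ty]]] := kP (a, b).
have {}ty : rho t y = y by apply: ty; apply: pfx_le yx; exact: leq_bigmax.
have := moved_maps td yab; rewrite ty; apply: moved_disjoint yab.
- exact: cone_closed.
- exact: cone_closed.
- by move=> _ _ /prefixP[z ->] /prefixP[z' ->]; exact: incomparable_cat.
Qed.

End Moved.

(** * Counting cones modulo n - 1 *)

Section Counting.
Local Open Scope nat_scope.
Variable n : nat.
Hypothesis n_gt1 : 1 < n.
Implicit Types (u v w c z : seq 'I_n) (x y : cantor n) (A B : set (cantor n)).

(** Compactness of the Cantor set, by following words that stay bad. *)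
Lemma uniform_depth (Q : set (seq 'I_n)) : extension_closed Q ->
  (forall x, exists k, Q (pfx k x)) -> exists k, forall v, size v = k -> Q v.
Proof.
move=> Qcl Qx; apply: contrapT => noQ.
pose bad v := forall k, exists u, size u = k /\ ~ Q (v ++ u).
have bad0 : bad [::].
  move=> k; apply: contrapT => nu; apply: noQ; exists k => v vk.
  by apply: contrapT => nv; apply: nu; exists v.
have /choice[f fP] : forall v, exists a, bad v -> bad (v ++ [:: a]).
  move=> v; have [bv|] := pselect (bad v); last by exists (letter0 n_gt1).
  apply: contrapT => na; have /choice[k kP] : forall a, exists k, forall u,
      size u = k -> Q (v ++ [:: a] ++ u).
    move=> a; apply: contrapT => nk; apply: na; exists a => _ k.
    apply: contrapT => nu; apply: nk; exists k => u uk.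
    by apply: contrapT => nQ; apply: nu; exists u; rewrite -catA.
  have [[|a u] [//= [us]]] := bv (\max_a k a).+1; apply.
  have ku : k a <= size u by rewrite us; exact: leq_bigmax.
  rewrite -(cat_take_drop (k a) u) -cat1s (catA [:: a]) catA; apply: Qcl.
  by apply: kP; rewrite size_takel.
pose V k := iter k (fun v => v ++ [:: f v]) [::].
pose x : cantor n := fun k => f (V k).
have xV k : pfx k x = V k by elim: k => // k IH; rewrite pfxS IH /= cats1.
have badV k : bad (V k) by elim: k => // k IH; exact: fP.
have [k Qk] := Qx x; have [u [/size0nil ->]] := badV k 0; rewrite cats0.
by apply; rewrite -xV.
Qed.

Lemma size_words k : size (words n k) = n ^ k.
Proof. by rewrite size_map -cardE card_tuple card_ord. Qed.

Lemma uniq_words k : uniq (words n k).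
Proof. by rewrite map_inj_uniq ?enum_uniq //; exact: val_inj. Qed.

Lemma count_prefix w k : size w <= k ->
  count (prefix w) (words n k) = n ^ (k - size w).
Proof.
move=> wk; rewrite -size_filter -size_words -(size_map (cat w)); apply: perm_size.
apply: uniq_perm; first by rewrite filter_uniq ?uniq_words.
  by rewrite map_inj_uniq ?uniq_words // => u v /eqP;
    rewrite eqseq_cat // eqxx => /eqP.
move=> t; rewrite mem_filter mem_words; apply/andP/mapP => [[/prefixP[u ->]]|[u]].
  by rewrite size_cat => /eqP <-; exists u; rewrite ?mem_words ?addKn.
rewrite mem_words => /eqP us ->; rewrite prefix_prefix size_cat us.
by rewrite subnKC.
Qed.

Lemma expn_mod_pred k : n ^ k = 1 %[mod n - 1].
Proof.
have e : n = 1 %[mod n - 1] by rewrite -{1}(subnK (ltnW n_gt1)) modnDl.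
by rewrite -modnXm e modnXm exp1n.
Qed.

Definition tiles (ws : seq (seq 'I_n)) A :=
  forall x, count (fun w => begins w x) ws = `[< A x >].

(** Cutting a cone into its children adds n - 1 cones, so the number of cones in a
    partition is well defined modulo n - 1. Here both partitions are compared with
    the one into cones of equal depth. *)
Lemma tiles_size ws ws' A : tiles ws A -> tiles ws' A ->
  size ws = size ws' %[mod n - 1].
Proof.
pose x0 : cantor n := fun=> letter0 n_gt1.
suff : forall s, tiles s A -> forall k, (forall w, w \in s -> size w <= k) ->
    size s = count (fun t => `[< A (prepend t x0) >]) (words n k) %[mod n - 1].
  move=> sP wsA ws'A; pose k := \max_(w <- ws ++ ws') size w.
  have wk w : w \in ws ++ ws' -> size w <= k.
    move=> wws; exact (@leq_bigmax_seq _ (ws ++ ws') xpredT size w wws isT).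
  rewrite (sP _ wsA k) => [|w ww]; last by apply: wk; rewrite mem_cat ww.
  by rewrite -(sP _ ws'A k) // => w ww; apply: wk; rewrite mem_cat ww orbT.
move=> s sA k sk; rewrite -sum1_count big_mkcond /=.
have -> : \sum_(t <- words n k) (if `[< A (prepend t x0) >] then 1 else 0) =
    \sum_(t <- words n k) \sum_(w <- s) prefix w t.
  apply: eq_big_seq => t; rewrite mem_words => /eqP tk.
  rewrite -[LHS]/(nat_of_bool `[< A (prepend t x0) >]) -sA -sum1_count big_mkcond /=.
  apply: eq_big_seq => w /sk wk; rewrite begins_prependE ?tk //;
    by case: (prefix w t).
rewrite exchange_big /= (eq_big_seq (fun w => n ^ (k - size w))); last first.
  move=> w /sk wk; rewrite -count_prefix // -sum1_count [RHS]big_mkcond /=.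
  by apply: eq_bigr => t _; case: (prefix w t).
rewrite -sum1_size; elim: s {sA sk} => [|w s IH]; first by rewrite !big_nil.
by rewrite !big_cons -modnDm -[RHS]modnDm IH expn_mod_pred.
Qed.

Definition determined k A := forall x y, pfx k x = pfx k y -> A x -> A y.

Definition tiling k A :=
  [seq v <- words n k | `[< A (prepend v (fun=> letter0 n_gt1)) >]].

Lemma tiling_tiles k A : determined k A -> tiles (tiling k A) A.
Proof.
move=> Ak x; have e : pfx k (prepend (pfx k x) (fun=> letter0 n_gt1)) = pfx k x.
  by rewrite -{1}(size_pfx k x) pfx_prepend.
have -> : count (fun w => begins w x) (tiling k A) = count_mem (pfx k x) (tiling k A).
  apply: eq_in_count => v; rewrite mem_filter mem_words /begins => /andP[_ /eqP ->]
    /=.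
  exact: eq_sym.
rewrite count_uniq_mem ?filter_uniq ?uniq_words // mem_filter mem_words size_pfx eqxx
  andbT.
by congr nat_of_bool; apply/asboolP/asboolP; apply: Ak; rewrite e.
Qed.

Lemma tiles_image (g : higman_thompson n) (r : seq 'I_n -> seq 'I_n) ws A B :
  (forall w, w \in ws -> maps g w (r w)) -> (forall x, A x <-> B (g x)) ->
  tiles ws A -> tiles (map r ws) B.
Proof.
move=> gr AB wsA x; rewrite count_map -[x](ht_invVK g).
have -> : `[< B (g ((g^-1)%g x)) >] = `[< A ((g^-1)%g x) >].
  by apply/asboolP/asboolP; apply AB.
rewrite -wsA; apply: eq_in_count => w wws /=.
by rewrite (maps_begins _ (gr w wws)).
Qed.

Lemma tiling_size_invariant (g : higman_thompson n) k A B :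
  determined k A -> determined k B -> (forall x, A x <-> B (g x)) ->
  size (tiling k A) = size (tiling k B) %[mod n - 1].
Proof.
move=> Ak Bk AB; have [l gl] := maps_dom n_gt1 g.
have /choice[r rP] : forall u, exists v, (l <= size u) -> maps g u v.
  by move=> u; case: (leqP l (size u)) => [/gl[v gv]|_]; [exists v|exists u].
have Akl : determined (k + l) A.
  by move=> x y xy; apply: Ak; exact: pfx_le (leq_addr _ _) xy.
rewrite (tiles_size (tiling_tiles Ak) (tiling_tiles Akl)).
rewrite -(size_map r); apply: tiles_size (tiling_tiles Bk).
apply: tiles_image AB (tiling_tiles Akl) => w; rewrite mem_filter mem_words.
by case/andP => _ /eqP wk; apply: rP; rewrite wk leq_addl.
Qed.

End Counting.

(** * Actions without unmoved points *)

Section Count_moved.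
Local Open Scope nat_scope.
Variables m n : nat.
Hypotheses (m_gt1 : 1 < m) (n_gt1 : 1 < n).
Variable rho : UMagmaMorphism.type (higman_thompson m) (higman_thompson n).
Implicit Types (a b : 'I_m) (c d e : seq 'I_m) (x y : cantor n).

Local Notation moved := (moved rho).

Lemma moved_cone_transport c d e : incomparable c d -> incomparable d e ->
  incomparable e c -> exists g, forall x, moved (cone c) x <-> moved (cone d) (rho g
    x).
Proof.
move=> cd de ec; have [g [_ [gcd _ _ _]]] := three_cycle_exists cd de ec.
exists g => y; split=> [|dy]; first exact: moved_maps.
rewrite -(ht_invK (rho g) y) -gmulfV; apply: moved_maps dy => //; exact: mapsV.
Qed.

Lemma sum_unique (P : 'I_m -> Prop) : (forall a b, P a -> P b -> a = b) ->
  \sum_a `[< P a >] = `[< exists a, P a >].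
Proof.
move=> Pu; case: asboolP => [[a Pa]|nP].
  rewrite (bigD1 a) //= asboolT // big1 ?addn0 // => b ba; rewrite asboolF // => Pb.
  by rewrite (Pu b a) ?eqxx in ba.
by rewrite big1 // => a _; rewrite asboolF // => Pa; apply: nP; exists a.
Qed.

Lemma moved_childP c x : moved (cone c) x <-> exists a, moved (cone (c ++ [:: a])) x.
Proof.
split=> [|[a]]; first exact: moved_child.
by apply: movedS => u /prefixP[z ->]; rewrite /cone /= -catA prefix_prefix.
Qed.

Lemma moved_child_unique c x a b :
  moved (cone (c ++ [:: a])) x -> moved (cone (c ++ [:: b])) x -> a = b.
Proof.
move=> ax; apply: contraPeq => ab; apply: moved_disjoint ax => //;
  try exact: cone_closed.
move=> _ _ /prefixP[z ->] /prefixP[z' ->]; apply: incomparable_cat.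
by rewrite incomparable_cat2l; apply: incomparable_size; rewrite // eqseq_cons andbT.
Qed.

(** The set moved by the cone of c is the disjoint union of the sets moved by its
    children, and the group permutes these sets transitively for c of depth 2. With
    t the common class of the latter modulo n - 1, a letter has class m t, which is
    also t because a letter is equivalent to a word of depth 2; and the whole space,
    of class 1, has class m (m t). *)
Lemma dvdn_of_all_moved : (forall x, moved setT x) -> n - 1 %| m - 1.
Proof.
move=> allm.
have moved_root x : moved (cone [::]) x by apply: movedS (allm x) => u _;
  exact: prefix0s.
have [N NP] : exists k, forall v, size v = k ->
    exists ab : 'I_m * 'I_m, forall x, begins v x -> moved (cone [:: ab.1; ab.2]) x.
  apply: (@uniform_depth n n_gt1 [set v | exists ab : 'I_m * 'I_m,
    forall x, begins v x -> moved (cone [:: ab.1; ab.2]) x]).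
    by move=> v z [ab vP]; exists ab => x /begins_catl; exact: vP.
  move=> x; have [a xa] := moved_child m_gt1 n_gt1 (moved_root x).
  have [b xab] := moved_child m_gt1 n_gt1 xa; have [k kP] := moved_near n_gt1 xab.
  by exists k, (a, b) => y /eqP; rewrite size_pfx => /esym; exact: kP.
have det2 a b : determined N (moved (cone [:: a; b])).
  move=> x y xy xab; have [|[a' b'] /= abP] := NP (pfx N x);
    first by rewrite size_pfx.
  have xab' := abP x (begins_pfx N x).
  have ax : moved (cone ([::] ++ [:: a])) x by apply/moved_childP; exists b.
  have a'x : moved (cone ([::] ++ [:: a'])) x by apply/moved_childP; exists b'.
  have aa := moved_child_unique ax a'x; subst a'.
  have bb := @moved_child_unique [:: a] x b b' xab xab'; subst b'.
  by apply: abP; rewrite xy; exact: begins_pfx.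
have det1 a : determined N (moved (cone [:: a])).
  move=> x y xy /moved_childP[b xab]; apply/(moved_childP [:: a]); exists b.
  exact: det2 xy xab.
pose s c := size (tiling n_gt1 N (moved (cone c))).
have split_s c : s c = \sum_a s (c ++ [:: a]).
  rewrite /s /tiling; under eq_bigr => a _ do rewrite size_filter -sum1_count
    big_mkcond.
  rewrite exchange_big /= size_filter -sum1_count big_mkcond /=;
    apply: eq_bigr => v _.
  rewrite -[LHS]/(nat_of_bool `[< _ >]) (sum_unique (P := fun a => _)).
    by congr nat_of_bool; apply/asboolP/asboolP => /moved_childP.
  by move=> a b; exact: moved_child_unique.
have equiv c d e : determined N (moved (cone c)) -> determined N (moved (cone d)) ->
    incomparable c d -> incomparable d e -> incomparable e c -> s c = s d %[mod n -
      1].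
  move=> cN dN cd de ec; have [g gP] := moved_cone_transport cd de ec.
  exact: tiling_size_invariant cN dN gP.
pose o := letter0 m_gt1; pose i1 := letter1 m_gt1.
have inc2 a b a' b' : (a, b) != (a', b') -> incomparable [:: a; b] [:: a'; b'].
  by move=> ne; apply: incomparable_size => //; rewrite !eqseq_cons andbT.
have s2 a b : s [:: a; b] = s [:: o; o] %[mod n - 1].
  have [[-> ->] //|ne] := eqVneq (a, b) (o, o).
  have [abE|ne'] := eqVneq (a, b) (o, i1).
    by apply: (equiv _ _ [:: i1; o]) => //; apply: inc2 => //; rewrite abE.
  by apply: (equiv _ _ [:: o; i1]) => //; apply: inc2 => //; rewrite eq_sym.
have sum_mod (f : 'I_m -> nat) r : (forall a, f a = r %[mod n - 1]) ->
    \sum_a f a = m * r %[mod n - 1].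
  move=> fr; rewrite -[in RHS](card_ord m) -sum_nat_const.
  by elim/big_ind2: _ => // x1 x2 y1 y2 e1 e2; rewrite -modnDm e1 e2 modnDm.
pose t := s [:: o; o].
have s1 a : s [:: a] = m * t %[mod n - 1] by rewrite split_s; apply: sum_mod => b;
  exact: s2.
have mt : m * t = t %[mod n - 1].
  by rewrite -(s1 o) -(s2 i1 o); apply: (equiv _ _ [:: i1; i1]).
have t1 : t = 1 %[mod n - 1].
  rewrite -(expn_mod_pred n_gt1 N) -size_words.
  have -> : size (words n N) = s [::].
    rewrite /s /tiling (eq_filter (a2 := xpredT)) ?filter_predT // => v.
    exact/asboolP.
  by rewrite split_s (sum_mod _ _ s1) -modnMmr mt modnMmr mt.
have m1 : m = 1 %[mod n - 1] by rewrite -t1 -mt -modnMmr t1 modnMmr muln1.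
by rewrite -eqn_mod_dvd ?m1 // ltnW.
Qed.

End Count_moved.

(** * The theorem *)

Section Unital.
Local Open Scope group_scope.

Lemma multiplicative_unital (G H : groupType) (f : {multiplicative G -> H}) :
  exists f' : UMagmaMorphism.type G H, f' =1 f.
Proof.
have f1 : f 1 = 1.
  by apply: (@mulgI _ (f 1)); rewrite -gmulfM !mulg1.
pose m := Multiplicative_isUMagmaMorphism.Build G H f f1.
pose m0 := isMultiplicative.Build G H f (@gmulfM _ _ f).
pose f' : UMagmaMorphism.type G H := HB.pack (f : G -> H) m0 m.
by exists f'.
Qed.

End Unital.

Theorem corollary1p10 (n m : nat) (hn : (2 <= n)%N) (hm : (2 <= m)%N)
    (hnm : ~~ (n - 1 %| m - 1)%N)
    (rho : {multiplicative higman_thompson m -> higman_thompson n}) :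
  exists U : set (cantor n),
    [/\ clopen U, U !=set0 &
        U `<=` global_fixed_points (rho @` derived_subgroup (higman_thompson m))].
Proof.
have [r rE] := multiplicative_unital rho.
have [x xfix] : exists x, ~ moved r setT x.
  apply: contrapT => nx; move/negP: hnm; apply.
  by apply: (dvdn_of_all_moved hm hn (rho := r)) => x; apply: contrapT => mx;
    apply: nx; exists x.
have [k kP] := unmoved_near hm hn xfix.
exists [set y | begins (pfx k x) y]; split.
- exact: clopen_begins.
- by exists x; exact: begins_pfx.
move=> y /eqP yx h [g gD <-]; rewrite -rE.
rewrite size_pfx in yx; have /not_movedP := kP y yx; apply.
exact: (derived_sub_alternating hm).
Qed.
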